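(* Let $M$ be a von Neumann algebra and let $T:M\to M$ be a linear map (not assumed continuous). Then the following statements are equivalent: (a) $T$ is a generalized derivation; (b) $aT(b)c=0$ whenever $a,b,c\in M$ satisfy $ab=bc=0$; (c) $aT(b)c=0$ whenever $a,b,c\in M_{sa}$ satisfy $ab=bc=0$; (d) $aT(b)c+cT(b)a=0$ whenever $a,b,c\in M_{sa}$ satisfy $ab=bc=0$; (e) $aT(b)a=0$ whenever $a,b\in M_{sa}$ satisfy $ab=0$; (f) for each $b\in M_{sa}$ we have $(1-r(b))T(b)(1-r(b))=0$, where $r(b)$ denotes the range projection of $b$ in $M$.
   Context: $M_{sa}$ denotes the set of self-adjoint elements of $M$. A linear map $G:M\to M$ is a generalized derivation if there exists $\xi\in M^{**}$ such that $G(ab)=G(a)b+aG(b)-a\xi b$ for all $a,b\in M$ (products taken in $M^{**}$). The range projection $r(b)$ of $b\in M_{sa}$ is the smallest projection $p\in M$ with $pb=b$. *)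

(* Defs.v *)
From HB Require Import structures.
From mathcomp Require Import all_boot all_order all_algebra.
From mathcomp Require Import complex.
From mathcomp Require Import all_classical all_reals all_analysis.

Set Implicit Arguments.
Unset Strict Implicit.
Unset Printing Implicit Defensive.

Import Order.TTheory GRing.Theory Num.Theory.
Import numFieldNormedType.Exports.

Local Open Scope classical_set_scope.
Local Open Scope ring_scope.
Local Open Scope complex_scope.

Section BoundedOperators.
Context {R : realType} (U V : normedModType R[i]).

Definition bounded_operator : {pred U -> V} :=
  [pred f : U -> V | `[< linear f /\ continuous f >]].

Lemma bounded_operator_closed : subsemimod_closed bounded_operator.
Proof.
split; first split.
- by apply/asboolP; split=> [k x y|x]; [rewrite /= scaler0 addr0 | exact: cvg_cst].
- move=> f g /asboolP[fL fC] /asboolP[gL gC]; apply/asboolP; split=> [k x y|x].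
    by rewrite !fctE fL gL scalerDr addrACA.
  exact: (cvgD (fC x) (gC x)).
- move=> c f /asboolP[fL fC]; apply/asboolP; split=> [k x y|x].
    by rewrite !fctE fL scalerDr !scalerA mulrC.
  exact: (cvgZr (fC x)).
Qed.

HB.instance Definition _ := GRing.isSubmodClosed.Build _ (U -> V)
  bounded_operator bounded_operator_closed.

Record bop := Bop { bop_fun :> U -> V; _ : bop_fun \in bounded_operator }.

HB.instance Definition _ := [isSub for bop_fun].
HB.instance Definition _ := [Choice of bop by <:].
HB.instance Definition _ := [SubChoice_isSubLmodule of bop by <:].

Lemma bop_linear (f : bop) : linear f.
Proof. by have /asboolP[] := valP f. Qed.

Lemma bop_continuous (f : bop) : continuous f.
Proof. by have /asboolP[] := valP f. Qed.

HB.instance Definition _ (f : bop) :=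
  GRing.isLinear.Build R[i] U V *:%R (bop_fun f) (bop_linear f).

Lemma bopP (f g : bop) : (forall x, f x = g x) -> f = g.
Proof. by move=> fg; apply/val_inj/funext. Qed.

(* The norm of a normedModType R[i] takes its values in R[i], so the supremum
   is taken over the real parts and injected back into R[i] below. *)
Definition opnorm (f : bop) : R :=
  sup [set complex.Re `|f x| | x in [set x : U | `|x| <= 1]].

Lemma bop_bounded (f : bop) :
  exists2 k : R[i], 0 <= k & forall x, `|f x| <= k * `|x|.
Proof.
have /linear_boundedP/pinfty_ex_gt0[k k0 fk] :=
  (linear_bounded_continuous (f : {linear U -> V})).2 (@bop_continuous f).
by exists k => //; exact: ltW.
Qed.

Let normE (W : normedModType R[i]) (x : W) : `|x| = (complex.Re `|x|)%:C.
Proof. by rewrite RRe_real// normr_real. Qed.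

Let opnorm_has_sup (f : bop) :
  has_sup [set complex.Re `|f x| | x in [set x : U | `|x| <= 1]].
Proof.
split; first by exists (complex.Re `|f 0|), 0 => //=; rewrite normr0.
have [k k0 fk] := bop_bounded f; exists (complex.Re k) => _ [x /= x1 <-].
rewrite -lecR -normE RRe_real ?ger0_real//.
by rewrite (le_trans (fk x))// ler_piMr.
Qed.

Lemma opnorm_ge (f : bop) x : `|f x| <= (opnorm f)%:C * `|x|.
Proof.
have [->|x0] := eqVneq x 0; first by rewrite linear0 !normr0 mulr0.
rewrite -ler_pdivrMr ?normr_gt0//.
have -> : `|f x| / `|x| = `|f (`|x|^-1 *: x)|.
  by rewrite linearZ normrZ normfV normr_id mulrC.
rewrite normE lecR; apply: ub_le_sup; first exact: (opnorm_has_sup f).2.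
exists (`|x|^-1 *: x) => //=.
by rewrite normrZ normfV normr_id mulVf ?normr_eq0.
Qed.

Lemma opnorm_le (f : bop) (k : R[i]) : 0 <= k ->
  (forall x, `|f x| <= k * `|x|) -> (opnorm f)%:C <= k.
Proof.
move=> k0 fk; rewrite -(RRe_real (ger0_real k0)) lecR.
apply: ge_sup; first exact: (opnorm_has_sup f).1.
move=> _ [x /= x1 <-]; rewrite -lecR -normE RRe_real ?ger0_real//.
by rewrite (le_trans (fk x))// ler_piMr.
Qed.

Lemma opnorm_ge0 (f : bop) : 0 <= (opnorm f)%:C :> R[i].
Proof.
rewrite lecR; apply: (@le_trans _ _ (complex.Re `|f 0|)).
  by rewrite linear0 normr0.
apply: ub_le_sup; first exact: (opnorm_has_sup f).2.
by exists 0 => //=; rewrite normr0.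
Qed.

Lemma opnormD (f g : bop) :
  (opnorm (f + g))%:C <= (opnorm f)%:C + (opnorm g)%:C :> R[i].
Proof.
apply: opnorm_le => [|x]; first by rewrite addr_ge0// opnorm_ge0.
by rewrite (le_trans (ler_normD _ _))// mulrDl lerD// opnorm_ge.
Qed.

Let opnormZ_le (k : R[i]) (f : bop) :
  (opnorm (k *: f))%:C <= `|k| * (opnorm f)%:C :> R[i].
Proof.
apply: opnorm_le => [|x]; first by rewrite mulr_ge0// opnorm_ge0.
by rewrite normrZ -mulrA ler_wpM2l// opnorm_ge.
Qed.

Lemma opnormZ (k : R[i]) (f : bop) :
  (opnorm (k *: f))%:C = `|k| * (opnorm f)%:C :> R[i].
Proof.
apply/eqP; rewrite eq_le opnormZ_le/=.
have [->|k0] := eqVneq k 0; first by rewrite normr0 mul0r opnorm_ge0.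
rewrite -ler_pdivlMl ?normr_gt0// -normfV.
by have := opnormZ_le k^-1 (k *: f); rewrite scalerA mulVf// scale1r.
Qed.

Lemma opnorm0_eq0 (f : bop) : (opnorm f)%:C = 0 :> R[i] -> f = 0.
Proof.
move=> f0; apply: bopP => x; apply/normr0_eq0/eqP; rewrite eq_le normr_ge0 andbT.
by have := opnorm_ge f x; rewrite f0 mul0r.
Qed.

HB.instance Definition _ :=
  Lmodule_isNormed.Build R[i] bop opnormD opnormZ opnorm0_eq0.

Lemma bop_norm_ge (f : bop) x : `|f x| <= `|f| * `|x|.
Proof. exact: opnorm_ge. Qed.

Lemma bop_norm_le (f : bop) (k : R[i]) : 0 <= k ->
  (forall x, `|f x| <= k * `|x|) -> `|f| <= k.
Proof. exact: opnorm_le. Qed.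

Lemma bounded_operatorP (f : U -> V) (k : R[i]) : linear f -> 0 <= k ->
  (forall x, `|f x| <= k * `|x|) -> f \in bounded_operator.
Proof.
move=> fL k0 fk; apply/asboolP; split=> //.
pose g := HB.pack_for {linear U -> V} f (GRing.isLinear.Build R[i] U V *:%R f fL).
apply: (@linear_bounded_continuous _ _ _ g).1.
apply/linear_boundedP; near=> r => x; rewrite (le_trans (fk x))// ler_wpM2r//.
by near: r; apply: nbhs_pinfty_ge; exact: ger0_real.
Unshelve. all: by end_near. Qed.

End BoundedOperators.
Arguments bounded_operator {R} U V.

Section OperatorAlgebra.
Context {R : realType} (H : normedModType R[i]).
Local Notation BH := (bop H H).

Lemma bop_id_subproof : idfun \in bounded_operator H H.
Proof. by apply/asboolP; split=> // x; exact: cvg_id. Qed.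

Lemma bop_comp_subproof (a b : BH) : (a \o b) \in bounded_operator H H.
Proof.
apply/asboolP; split=> [k x y|x]; first by rewrite /= !linearP.
by apply: continuous_comp; exact: bop_continuous.
Qed.

Definition bop_id : BH := Bop bop_id_subproof.
Definition bop_comp (a b : BH) : BH := Bop (bop_comp_subproof a b).

Lemma bop_compA : associative bop_comp.
Proof. by move=> a b c; apply: bopP. Qed.
Lemma bop_comp1l : left_id bop_id bop_comp.
Proof. by move=> a; apply: bopP. Qed.
Lemma bop_comp1r : right_id bop_id bop_comp.
Proof. by move=> a; apply: bopP. Qed.
Lemma bop_compDl : left_distributive bop_comp +%R.
Proof. by move=> a b c; apply: bopP. Qed.
Lemma bop_compDr : right_distributive bop_comp +%R.
Proof. by move=> a b c; apply: bopP => x; exact: linearD. Qed.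

(* B(H) is only a pzRingType, as H may be zero; this rules out lalgType, hence
   the compatibilities of products with scalars are stated separately. *)
HB.instance Definition _ := GRing.Zmodule_isPzRing.Build BH
  bop_compA bop_comp1l bop_comp1r bop_compDl bop_compDr.

End OperatorAlgebra.

Record hilbertSpace (R : realType) := HilbertSpace {
  hs_sort :> completeNormedModType R[i];
  hs_dot : {dot hs_sort for Num.conj};
  hs_norm : forall x : hs_sort, `|x| ^+ 2 = hs_dot x x }.

Section VonNeumann.
Context {R : realType} (H : hilbertSpace R).
Local Notation BH := (bop H H).

Definition is_adjoint (a b : BH) :=
  forall x y : H, hs_dot H (a x) y = hs_dot H x (b y).

Definition commutant (A : {pred BH}) : {pred BH} :=
  [pred a : BH | `[< forall b, b \in A -> a * b = b * a >]].

(* A self-adjoint subset of B(H) equal to its bicommutant; it is automatically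
   a unital subalgebra, see vN_submod and vN_mul. *)
Record vonNeumannAlgebra := VonNeumannAlgebra {
  vN_pred : {pred BH};
  vN_star : forall a, a \in vN_pred ->
    exists2 b, b \in vN_pred & is_adjoint a b;
  vN_bicommutant : commutant (commutant vN_pred) =i vN_pred }.

Lemma commutant_submod (A : {pred BH}) : subsemimod_closed (commutant A).
Proof.
split; first split.
- by apply/asboolP=> b bA; rewrite mul0r mulr0.
- move=> a b /asboolP aA /asboolP bA; apply/asboolP=> c cA.
  by rewrite mulrDl mulrDr aA// bA.
- move=> k a /asboolP aA; apply/asboolP=> c cA; apply: bopP => x /=.
  by rewrite linearZ; congr (_ *: _); have /(congr1 (fun f : BH => f x)) := aA _ cA.
Qed.

Lemma commutant_mul (A : {pred BH}) : mulr_closed (commutant A).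
Proof.
split; first by apply/asboolP=> b bA; rewrite mul1r mulr1.
move=> a b /asboolP aA /asboolP bA; apply/asboolP=> c cA.
by rewrite -mulrA bA// mulrA aA// mulrA.
Qed.

Section Instances.
Variable M : vonNeumannAlgebra.

Lemma vN_submod : subsemimod_closed (vN_pred M).
Proof.
have [[C0 CD] CZ] := commutant_submod (commutant (vN_pred M)).
split; first split.
- by rewrite -vN_bicommutant.
- by move=> a b; rewrite -!vN_bicommutant; exact: CD.
- by move=> k a; rewrite -!vN_bicommutant; exact: CZ.
Qed.

Lemma vN_mul : mulr_closed (vN_pred M).
Proof.
have [C1 CM] := commutant_mul (commutant (vN_pred M)).
split; first by rewrite -vN_bicommutant.
by move=> a b; rewrite -!vN_bicommutant; exact: CM.
Qed.

HB.instance Definition _ :=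
  GRing.isSubmodClosed.Build R[i] BH (vN_pred M) vN_submod.
HB.instance Definition _ := GRing.isMulClosed.Build BH (vN_pred M) vN_mul.

Record vN_sort := VNSort { vN_val :> BH; _ : vN_val \in vN_pred M }.

HB.instance Definition _ := [isSub for vN_val].
HB.instance Definition _ := [Choice of vN_sort by <:].
HB.instance Definition _ := [SubChoice_isSubLmodule of vN_sort by <:].
HB.instance Definition _ := GRing.SubNmodule_isSubPzSemiRing.Build
  BH (vN_pred M) vN_sort vN_mul.

Lemma vN_normD (a b : vN_sort) :
  `|vN_val (a + b)| <= `|vN_val a| + `|vN_val b|.
Proof. exact: ler_normD. Qed.

Lemma vN_normZ (k : R[i]) (a : vN_sort) :
  `|vN_val (k *: a)| = `|k| * `|vN_val a|.
Proof. exact: normrZ. Qed.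

Lemma vN_norm0_eq0 (a : vN_sort) : `|vN_val a| = 0 -> a = 0.
Proof. by move=> /normr0_eq0 a0; exact/val_inj. Qed.

HB.instance Definition _ :=
  Lmodule_isNormed.Build R[i] vN_sort vN_normD vN_normZ vN_norm0_eq0.

Lemma vN_scalerAl (k : R[i]) (a b : vN_sort) : k *: (a * b) = k *: a * b.
Proof. by apply/val_inj/bopP. Qed.

Lemma vN_scalerAr (k : R[i]) (a b : vN_sort) : k *: (a * b) = a * (k *: b).
Proof. by apply/val_inj/bopP => x; rewrite [RHS]linearZ. Qed.

Lemma vN_normM (a b : vN_sort) : `|a * b| <= `|a| * `|b|.
Proof.
apply: bop_norm_le => [|x]; first by rewrite mulr_ge0.
rewrite (le_trans (bop_norm_ge (vN_val a) _))// -mulrA ler_wpM2l//.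
exact: bop_norm_ge.
Qed.

End Instances.
End VonNeumann.

Coercion vN_sort : vonNeumannAlgebra >-> Sortclass.

Section Bidual.
Context {R : realType} (V : normedModType R[i]).

Definition dual := bop V R[i]^o.
Definition bidual := bop dual R[i]^o.

End Bidual.

Section ArensProduct.
Context {R : realType} {H : hilbertSpace R} {M : vonNeumannAlgebra H}.

Lemma bidual_in_subproof (a : M) :
  (fun f : dual M => f a) \in bounded_operator (dual M) R[i]^o.
Proof.
apply: (@bounded_operatorP _ _ _ _ `|a|) => // f.
by rewrite mulrC; exact: bop_norm_ge.
Qed.

Definition bidual_in (a : M) : bidual M := Bop (bidual_in_subproof a).

Lemma dual_act_subproof (f : dual M) (a : M) :
  (fun b : M => f (a * b)) \in bounded_operator M R[i]^o.
Proof.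
apply: (@bounded_operatorP _ _ _ _ (`|f| * `|a|)) => [k b c||b].
- by rewrite mulrDr -vN_scalerAr linearP.
- by rewrite mulr_ge0.
- rewrite (le_trans (bop_norm_ge f _))// -mulrA ler_wpM2l//; exact: vN_normM.
Qed.

Definition dual_act (f : dual M) (a : M) : dual M := Bop (dual_act_subproof f a).

Lemma bidual_act_subproof (n : bidual M) (f : dual M) :
  (fun a : M => n (dual_act f a)) \in bounded_operator M R[i]^o.
Proof.
apply: (@bounded_operatorP _ _ _ _ (`|n| * `|f|)) => [k a b||a].
- rewrite /= -linearP; congr (n _); apply: bopP => c /=.
  by rewrite mulrDl -vN_scalerAl linearP.
- by rewrite mulr_ge0.
- rewrite (le_trans (bop_norm_ge n _))// -mulrA ler_wpM2l//.
  apply: bop_norm_le => [|b]; first by rewrite mulr_ge0.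
  rewrite /= (le_trans (bop_norm_ge f _))// -mulrA ler_wpM2l//; exact: vN_normM.
Qed.

Definition bidual_act (n : bidual M) (f : dual M) : dual M :=
  Bop (bidual_act_subproof n f).

Lemma arens_subproof (m n : bidual M) :
  (fun f : dual M => m (bidual_act n f)) \in bounded_operator (dual M) R[i]^o.
Proof.
apply: (@bounded_operatorP _ _ _ _ (`|m| * `|n|)) => [k f g||f].
- rewrite /= -linearP; congr (m _); apply: bopP => a /=.
  have -> : dual_act (k *: f + g) a = k *: dual_act f a + dual_act g a.
    exact: bopP.
  exact: linearP.
- by rewrite mulr_ge0.
- rewrite (le_trans (bop_norm_ge m _))// -mulrA ler_wpM2l//.
  apply: bop_norm_le => [|a]; first by rewrite mulr_ge0.
  rewrite /= (le_trans (bop_norm_ge n _))// -mulrA ler_wpM2l//.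
  apply: bop_norm_le => [|b]; first by rewrite mulr_ge0.
  rewrite /= (le_trans (bop_norm_ge f _))// -mulrA ler_wpM2l//; exact: vN_normM.
Qed.

(* The first Arens product: (f.a)(b) = f(ab), (n.f)(a) = n(f.a) and
   (m n)(f) = m(n.f). *)
Definition arens (m n : bidual M) : bidual M := Bop (arens_subproof m n).

Lemma arens_bidual_in (a b : M) :
  arens (bidual_in a) (bidual_in b) = bidual_in (a * b).
Proof. exact: bopP. Qed.

End ArensProduct.

Section GeneralizedDerivations.
Context {R : realType} {H : hilbertSpace R} {M : vonNeumannAlgebra H}.

Definition generalized_derivation (G : M -> M) := linear G /\
  exists xi : bidual M, forall a b : M,
    bidual_in (G (a * b)) =
      arens (bidual_in (G a)) (bidual_in b)
      + arens (bidual_in a) (bidual_in (G b))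
      - arens (arens (bidual_in a) xi) (bidual_in b).

Definition selfadjoint (a : M) := is_adjoint a a.

Definition projection (p : M) := selfadjoint p /\ p * p = p.

Definition proj_le (p q : M) := p * q = p.

Definition is_range_projection (b p : M) :=
  [/\ projection p, p * b = b &
      forall q : M, projection q -> q * b = b -> proj_le p q].

(* The smallest such projection is unique, and it exists when b is self-adjoint;
   0 is a dummy value. *)
Definition range_projection (b : M) : M :=
  xget 0 [set p | is_range_projection b p].

End GeneralizedDerivations.

(* Main.v *)
Require Import Defs.
From mathcomp Require Import all_boot all_order all_algebra.
From mathcomp Require Import complex.
From mathcomp Require Import all_classical all_reals all_analysis.
From mathcomp Require Import ring lra.

Set Implicit Arguments.
Unset Strict Implicit.

Import Order.TTheory GRing.Theory Num.Theory.
Import numFieldNormedType.Exports.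

Local Open Scope classical_set_scope.
Local Open Scope ring_scope.
Local Open Scope complex_scope.

(** Only the implication from (f) to (a) is hard. With g = T(1)/2 and
    D x = T x - (g x + x g), it says that a linear D with D 1 = 0, such that
    p (D b) p = 0 whenever p is a projection with p b = b p = 0, is a
    derivation ([local_map_derivation]). The failure of D to be a derivation is
    the defect E(a, b) = D (a b) - (D a) b - a (D b), a Hochschild 2-cocycle.

    The analytic engine is [projection_module_vanish]: no continuity is known,
    but a real-linear phi : M -> H with phi 1 = 0 that satisfies
    phi (e a) = e (phi a) for projections e and elements a of the bicommutant
    of a self-adjoint x must vanish at x. Suppose y = phi x is not 0. Bisecting
    the spectrum of x, and keeping at each step the half that carries more of
    y, yields decreasing projections f_n on whose range x is within r / 2^n of
    a scalar c_n, while |f_n y| decays no faster than 2^(-n/2). On the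
    intersection of these ranges x is a scalar, and phi 1 = 0 shows that y has
    no component there. Put d_n = f_n - f_(n+1). The series
    g = sum_n (3/2)^n d_n (x - c_n) converges since 3/2 < 2, and
    d_n (phi g) = (3/2)^n d_n y gives |d_n y| = O((2/3)^n). Summing,
    |f_n y| = O((2/3)^n), which contradicts the lower bound since
    (2/3)^2 < 1/2. The only spectral theory needed is [symmetry_approx], which
    splits the spectrum in two; it rests on the modulus of a self-adjoint
    operator and on kernel projections, both built as limits of polynomials.

    The rest is algebra. For a projection p the engine determines
    (1 - p) (D x) on the corner p M p, and this gives E(e, b) = 0 when the
    projection e commutes with b ([defect_comm]). By the cocycle identity,
    a |-> E(a, x) v is then a map to which the engine applies, so E(x, x) = 0
    for self-adjoint x, that is, D is a Jordan derivation. The Jordan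
    identities between corners e M (1 - e) and (1 - e) M e force E(e, b) = 0 for
    every b ([defect_corner], [defect_proj]); now a |-> E(a, b) v is a map of
    the same kind, and E = 0.

    For the implication from (a) to (b), the identity at the pair (a, b) is
    evaluated on the functionals y |-> <y c v, w>: they vanish on M b since
    b c = 0, which removes the term with xi although xi lies only in the bidual.
    Then (c), (d) and (e) are specializations, and (f) is (e) with
    a = 1 - r(b), once r(b) is known to exist. *)

(** * The real inner product of a complex Hilbert space *)

Section RealStructure.
Context {R : realType} {H : hilbertSpace R}.
Implicit Types (u v w : H) (r : R).

(** Scalars and norms of H take values in R[i]. Estimates are made in R instead,
    with the real part of the inner product; by [ip_adjointP] this loses no
    information about adjoints. *)
Definition ip u v : R := complex.Re (hs_dot H u v).
Definition nm v : R := complex.Re `|v|.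

Lemma Re_realM r (z : R[i]) : complex.Re (r%:C * z) = r * complex.Re z.
Proof. by case: z => x y /=; rewrite mul0r subr0. Qed.

Lemma ipC u v : ip u v = ip v u.
Proof.
rewrite /ip (hermC (hs_dot H)) expr0 mul1r /=.
by case: (hs_dot H v u).
Qed.

Lemma ipDl u v w : ip (u + v) w = ip u w + ip v w.
Proof. by rewrite /ip linearDl raddfD. Qed.

Lemma ipDr u v w : ip w (u + v) = ip w u + ip w v.
Proof. by rewrite ipC ipDl !(ipC _ w). Qed.

Lemma ipNl u w : ip (- u) w = - ip u w.
Proof. by rewrite /ip linearNl raddfN. Qed.

Lemma ipNr u w : ip w (- u) = - ip w u.
Proof. by rewrite ipC ipNl ipC. Qed.

Lemma ipZl r u w : ip (r%:C *: u) w = r * ip u w.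
Proof.
by rewrite /ip linearZl_LR Re_realM.
Qed.

Lemma ipZr r u w : ip w (r%:C *: u) = r * ip w u.
Proof. by rewrite ipC ipZl ipC. Qed.

Lemma ip0l w : ip 0 w = 0.
Proof. by rewrite /ip linear0l. Qed.

Lemma ip0r w : ip w 0 = 0.
Proof. by rewrite ipC ip0l. Qed.

Definition ipE := (ipDl, ipDr, ipNl, ipNr, ipZl, ipZr, ip0l, ip0r).

Lemma normcE v : `|v| = (nm v)%:C.
Proof. by rewrite /nm RRe_real// normr_real. Qed.

Lemma nm_ge0 v : 0 <= nm v.
Proof. by rewrite -lecR -normcE; exact: normr_ge0. Qed.

Lemma ip_nm v : ip v v = nm v ^+ 2.
Proof. by rewrite /ip -hs_norm normcE -rmorphXn. Qed.

Lemma nm0 : nm 0 = 0.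
Proof. by rewrite /nm normr0. Qed.

Lemma nm_eq0 v : nm v = 0 -> v = 0.
Proof. by move=> v0; apply: normr0_eq0; rewrite normcE v0. Qed.

Lemma nmD u v : nm (u + v) <= nm u + nm v.
Proof. by have := ler_normD u v; rewrite !normcE -rmorphD lecR. Qed.

Lemma nmN v : nm (- v) = nm v.
Proof. by rewrite /nm normrN. Qed.

Lemma nm_distC u v : nm (u - v) = nm (v - u).
Proof. by rewrite -nmN opprB. Qed.

Lemma nmZc (k : R[i]) v : nm (k *: v) = complex.Re `|k| * nm v.
Proof.
rewrite /nm normrZ -(RRe_real (normr_real k)) Re_realM.
by rewrite RRe_real ?normr_real.
Qed.

Lemma nmZ r v : nm (r%:C *: v) = `|r| * nm v.
Proof. by rewrite nmZc normc_def /= expr0n addr0 sqrtr_sqr. Qed.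

Lemma nm_sqD u v : nm (u + v) ^+ 2 = nm u ^+ 2 + 2 * ip u v + nm v ^+ 2.
Proof. by rewrite -!ip_nm !ipE (ipC v u); ring. Qed.

Lemma nm_sqB u v : nm (u - v) ^+ 2 = nm u ^+ 2 - 2 * ip u v + nm v ^+ 2.
Proof. by rewrite nm_sqD nmN ipNr; ring. Qed.

Lemma ip_CS u v : ip u v <= nm u * nm v.
Proof.
have [u0|u0] := eqVneq (nm u) 0.
  by rewrite (nm_eq0 u0) ip0l nm0 mul0r.
have up : 0 < nm u by rewrite lt_def u0 nm_ge0.
rewrite -(ler_pM2l up) -(ler_pM2r (_ : 0 < 2)) //.
have [v0|v0] := eqVneq (nm v) 0.
  by rewrite (nm_eq0 v0) ip0r nm0 !(mulr0,mul0r).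
have vp : 0 < nm v by rewrite lt_def v0 nm_ge0.
rewrite -(ler_pM2l vp).
have := sqr_ge0 (nm ((nm v)%:C *: u - (nm u)%:C *: v)).
rewrite nm_sqB !ipE !nmZ !ger0_norm ?nm_ge0// !exprMn.
nra.
Qed.

Lemma ip_eq0 u : (forall v, ip u v = 0) -> u = 0.
Proof.
move=> u0; apply: nm_eq0; apply/eqP; by rewrite -sqrf_eq0 -ip_nm u0.
Qed.

(** Replacing v by i v recovers the imaginary part, so the complex inner product
    is determined by the real one. *)
Lemma ip_iIm u v : complex.Im (hs_dot H u v) = ip u ('i%C *: v).
Proof.
have -> : ip u ('i%C *: v) = complex.Re ((0 -i* 1)%C * hs_dot H u v).
  by rewrite /ip linearZ_LR.
by case: (hs_dot H u v) => x y /=; rewrite mul0r mulN1r opprK add0r.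
Qed.

Lemma ip_iC u v : ip ('i%C *: u) v = - ip u ('i%C *: v).
Proof.
have -> : ip ('i%C *: u) v = complex.Re ('i%C * hs_dot H u v).
  by rewrite /ip linearZl_LR.
by rewrite -ip_iIm mulrC ReiNIm.
Qed.

Lemma ip_adjointP (a b : bop H H) :
  is_adjoint a b <-> forall u v, ip (a u) v = ip u (b v).
Proof.
split=> [ab u v|ab u v]; first by rewrite /ip ab.
apply/eqP; rewrite eq_complex; apply/andP; split; apply/eqP; first exact: ab.
by rewrite !ip_iIm ab linearZ.
Qed.

Definition conv (u : nat -> H) (l : H) :=
  (fun n => nm (u n - l)) @ \oo --> (0 : R).

Lemma conv_le (u : nat -> H) l (d : nat -> R) :
  (forall n, nm (u n - l) <= d n) -> d @ \oo --> (0 : R) -> conv u l.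
Proof.
move=> ud d0; apply: (squeeze_cvgr _ (cvg_cst 0) d0).
by apply: nearW => n; rewrite nm_ge0 ud.
Qed.

Lemma conv_cst u : conv (fun=> u) u.
Proof. by rewrite /conv subrr nm0; exact: cvg_cst. Qed.

Lemma conv_unique (u : nat -> H) l l' : conv u l -> conv u l' -> l = l'.
Proof.
move=> ul ul'; apply/subr0_eq/nm_eq0/eqP; rewrite eq_le nm_ge0 andbT.
have s : (fun n => nm (u n - l) + nm (u n - l')) @ \oo --> (0 + 0 : R) by apply: cvgD.
rewrite addr0 in s.
apply: (cvgr_to_ge s).
apply: nearW => n; rewrite (nm_distC (u n) l).
by apply: le_trans (nmD _ _); rewrite addrA subrK.
Qed.

Lemma convD (u v : nat -> H) l l' : conv u l -> conv v l' ->
  conv (fun n => u n + v n) (l + l').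
Proof.
move=> ul vl; apply: (@conv_le _ _ (fun n => nm (u n - l) + nm (v n - l'))).
  by move=> n; rewrite opprD addrACA nmD.
by rewrite -[0]addr0; apply: cvgD.
Qed.

Lemma convN (u : nat -> H) l : conv u l -> conv (fun n => - u n) (- l).
Proof.
by move=> ul; apply: conv_le ul => n; rewrite -opprD nmN.
Qed.

Lemma convZ (k : R[i]) (u : nat -> H) l : conv u l ->
  conv (fun n => k *: u n) (k *: l).
Proof.
move=> ul; apply: (@conv_le _ _ (fun n => complex.Re `|k| * nm (u n - l))).
  by move=> n; rewrite -scalerBr nmZc.
by rewrite -(mulr0 (complex.Re `|k|)); apply: cvgM => //; exact: cvg_cst.
Qed.

Lemma conv_shift k (u : nat -> H) l : conv u l -> conv (fun n => u (n + k)%N) l.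
Proof. by rewrite /conv -(cvg_shiftn k (fun n => nm (u n - l)) (nbhs (0 : R))). Qed.

Lemma conv_ip (u : nat -> H) l w : conv u l ->
  (fun n => ip (u n) w) @ \oo --> ip l w.
Proof.
move=> ul; apply/subr_cvg0.
have d0 : (fun n => nm (u n - l) * nm w) @ \oo --> (0 : R).
  by rewrite -(mul0r (nm w)); apply: cvgM => //; exact: cvg_cst.
have d0' : (fun n => - (nm (u n - l) * nm w)) @ \oo --> (0 : R).
  by rewrite -oppr0; apply: cvgN.
apply: (squeeze_cvgr _ d0' d0); apply: nearW => n.
rewrite -ipNl -ipDl ip_CS andbT lerNl -ipNl.
by apply: le_trans (ip_CS _ _) _; rewrite nmN.
Qed.

Lemma conv_nm_le (u : nat -> H) l r : conv u l -> (forall n, nm (u n) <= r) ->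
  nm l <= r.
Proof.
move=> ul ur.
have s : (fun n => r + nm (u n - l)) @ \oo --> (r + 0) by apply: cvgD => //; exact: cvg_cst.
rewrite addr0 in s.
apply: (cvgr_to_ge s); apply: nearW => n.
rewrite -[X in nm X <= _](subKr (u n)); apply: le_trans (nmD _ _) _.
by rewrite nmN lerD2r.
Qed.

(** A Cauchy criterion with a certificate: increments controlled by a
    nonincreasing nonnegative real sequence. All the limits taken below come with
    such a sequence. *)
Lemma conv_complete (u : nat -> H) (s : nat -> R) : (forall n, 0 <= s n) ->
  (forall n m, (n <= m)%N -> nm (u m - u n) ^+ 2 <= s n - s m) ->
  exists l, conv u l.
Proof.
move=> s0 us.
have dec : nonincreasing_seq s.
  by move=> n m nm'; rewrite -subr_ge0 (le_trans _ (us _ _ nm')) ?sqr_ge0.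
have cs : cvgn s by apply: nonincreasing_is_cvgn => //; exists 0 => _ [n _ <-].
have lims n : limn s <= s n by apply: nonincreasing_cvgn_ge.
have cu : cauchy (u @ \oo).
  apply: cauchy_exP => e e0.
  have [e' e'0 ee'] : exists2 e' : R, 0 < e' & e = e'%:C.
    exists (complex.Re e); last by rewrite RRe_real// gtr0_real.
    by rewrite -ltcR RRe_real// gtr0_real.
  have /cvgrPdist_lt/(_ (e' ^+ 2)) := cs.
  move=> /(_ (exprn_gt0 _ e'0)) [N _ HN].
  exists (u N); exists N => //= n Nn.
  rewrite -ball_normE /= normcE ee' ltcR nm_distC.
  rewrite -(ltr_pXn2r (_ : (0 < 2)%N)) ?nnegrE ?nm_ge0 ?ltW//.
  apply: le_lt_trans (us _ _ Nn) _.
  apply: le_lt_trans (HN N (leqnn _)).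
  rewrite /= distrC ger0_norm ?subr_ge0//.
  by rewrite lerD2l lerN2.
have /cauchy_cvgP cu' := cu.
exists (lim (u @ \oo)).
apply/cvgrPdist_lt => e e0.
have /cvgrPdist_lt/(_ e%:C) := cu'.
rewrite ltcR => /(_ e0); apply: filterS => n.
by rewrite sub0r normrN ger0_norm ?nm_ge0// normcE nm_distC ltcR.
Qed.

End RealStructure.
(** * Adjoints and strong limits in a von Neumann algebra *)

Section StrongLimits.
Context {R : realType} {H : hilbertSpace R} {M : vonNeumannAlgebra H}.
Implicit Types (u v w : H) (r : R) (a b c : M).

Lemma opDE a b v : (a + b) v = a v + b v. Proof. by []. Qed.
Lemma opNE a v : (- a) v = - a v. Proof. by []. Qed.
Lemma opME a b v : (a * b) v = a (b v). Proof. by []. Qed.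
Lemma op1E v : (1 : M) v = v. Proof. by []. Qed.
Lemma op0E v : (0 : M) v = 0. Proof. by []. Qed.
Lemma opZE (k : R[i]) a v : (k *: a) v = k *: a v. Proof. by []. Qed.
Definition opE := (opDE, opNE, opME, op1E, op0E, opZE).

Lemma opP a b : (forall v, a v = b v) -> a = b.
Proof. by move=> ab; apply/val_inj/bopP. Qed.

(** Bounds with constants in R avoid both the R[i]-valued operator norm and its
    supremum. *)
Definition bnd (a : bop H H) (r : R) := forall v, nm (a v) <= r * nm v.

Lemma bnd_ex (a : bop H H) : exists2 r, 0 <= r & bnd a r.
Proof.
have [k k0 ak] := bop_bounded a; exists (complex.Re k).
  by rewrite -lecR RRe_real// ger0_real.
move=> v; have := ak v.
by rewrite -(RRe_real (ger0_real k0)) !normcE -rmorphM lecR /=.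
Qed.

Lemma bnd_le a r r' : r <= r' -> bnd a r -> bnd a r'.
Proof. by move=> rr' ar v; rewrite (le_trans (ar v))// ler_wpM2r// nm_ge0. Qed.

Lemma bndM a b r r' : 0 <= r -> bnd a r -> bnd b r' -> bnd (a * b) (r * r').
Proof.
move=> r0 ar br v; rewrite !opE (le_trans (ar _))// -mulrA ler_wpM2l//.
Qed.

Lemma bndD a b r r' : bnd a r -> bnd b r' -> bnd (a + b) (r + r').
Proof.
move=> ar br v; rewrite !opE (le_trans (nmD _ _))// mulrDl lerD//.
Qed.

Lemma bndZ a r s : bnd a r -> bnd (s%:C *: a) (`|s| * r).
Proof. by move=> ar v; rewrite !opE nmZ -mulrA ler_wpM2l. Qed.

Lemma adj_ex a : exists b : M, forall u v, ip (a u) v = ip u (b v).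
Proof.
have [b bM ab] := vN_star (valP a); exists (VNSort bM).
exact/ip_adjointP.
Qed.

Definition adj a : M := projT1 (cid (adj_ex a)).

Lemma adjP a u v : ip (a u) v = ip u (adj a v).
Proof. by rewrite /adj; case: cid. Qed.

Lemma adj_uniq a b : (forall u v, ip (a u) v = ip u (b v)) -> adj a = b.
Proof.
move=> ab; apply: opP => v; apply/subr0_eq/ip_eq0 => u.
by rewrite ipDl ipNl !(ipC _ u) -adjP ab subrr.
Qed.

Lemma adjK : involutive adj.
Proof. by move=> a; apply: adj_uniq => u v; rewrite ipC -adjP ipC. Qed.

Lemma adjD a b : adj (a + b) = adj a + adj b.
Proof. by apply: adj_uniq => u v; rewrite !opE !ipE !adjP. Qed.

Lemma adjN a : adj (- a) = - adj a.
Proof. by apply: adj_uniq => u v; rewrite !opE !ipE !adjP. Qed.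

Lemma adjB a b : adj (a - b) = adj a - adj b.
Proof. by rewrite adjD adjN. Qed.

Lemma adjM a b : adj (a * b) = adj b * adj a.
Proof. by apply: adj_uniq => u v; rewrite !opE !adjP. Qed.

Lemma adj1 : adj 1 = 1.
Proof. exact: adj_uniq. Qed.

Lemma adj0 : adj 0 = 0.
Proof. by apply: adj_uniq => u v; rewrite !opE !ipE. Qed.

Lemma adjZ r a : adj (r%:C *: a) = r%:C *: adj a.
Proof. by apply: adj_uniq => u v; rewrite !opE !ipE !adjP. Qed.

Lemma adjZi a : adj ('i%C *: a) = - ('i%C *: adj a).
Proof.
apply: adj_uniq => u v; rewrite !opE ipNr.
by rewrite ip_iC adjP linearZ.
Qed.

Lemma selfadjointP a : selfadjoint a <-> adj a = a.
Proof.
split=> [/ip_adjointP/adj_uniq//|sa]; apply/ip_adjointP => u v.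
by rewrite adjP sa.
Qed.

Lemma sa_ip a u v : adj a = a -> ip (a u) v = ip u (a v).
Proof. by move=> sa; rewrite adjP sa. Qed.

(** The real and imaginary parts of a. They are combinations of a and its
    adjoint, so a projection that annihilates a on both sides annihilates them. *)
Lemma sa_parts a : exists x y,
  [/\ adj x = x, adj y = y, a = x + 'i%C *: y &
    forall p, adj p = p -> p * a = 0 -> a * p = 0 -> p * x = 0 /\ p * y = 0].
Proof.
pose h : R[i] := (2^-1)%:C.
have hh : h + h = 1 by rewrite /h -rmorphD; congr _%:C; lra.
have ihi : 'i%C * h * 'i%C = - h.
  by rewrite mulrAC mulrC -expr2 sqr_i mulrN1.
exists (h *: (a + adj a)), (h *: ('i%C *: (adj a - a))); split.
- by rewrite adjZ adjD adjK addrC.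
- by rewrite adjZ adjZi adjB adjK -scalerN opprB.
- rewrite !scalerA ihi scaleNr -scalerBr opprB addrC.
  by rewrite addrACA addNr addr0 scalerDr -scalerDl hh scale1r.
- move=> p sp pa ap.
  have pa' : p * adj a = 0 by rewrite -sp -adjM ap adj0.
  by rewrite -!vN_scalerAr mulrDr mulrBr pa pa' subr0 addr0 !scaler0.
Qed.

Lemma adj_mul_eq0 a : adj a * a = 0 -> a = 0.
Proof.
move=> aa; apply: opP => v; apply: nm_eq0; apply/eqP.
by rewrite -sqrf_eq0 -ip_nm adjP -opME aa ip0r.
Qed.

Definition slim (a : nat -> M) (b : M) := forall v, conv (fun n => a n v) (b v).

Lemma slim_unique (a : nat -> M) b c : slim a b -> slim a c -> b = c.
Proof. by move=> ab ac; apply: opP => v; apply: conv_unique (ab v) (ac v). Qed.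

Lemma slim_cst a : slim (fun=> a) a.
Proof. by move=> v; exact: conv_cst. Qed.

Lemma slimD (a b : nat -> M) a' b' : slim a a' -> slim b b' ->
  slim (fun n => a n + b n) (a' + b').
Proof.
move=> aa bb v; change (conv (fun n => a n v + b n v) (a' v + b' v)).
exact: convD (aa v) (bb v).
Qed.

Lemma slimZ (k : R[i]) (a : nat -> M) a' : slim a a' ->
  slim (fun n => k *: a n) (k *: a').
Proof.
move=> aa v; change (conv (fun n => k *: a n v) (k *: a' v)).
have Z := convZ k (aa v); exact: Z.
Qed.

Lemma slimM (a b : nat -> M) a' b' r : (forall n, bnd (a n) r) ->
  slim a a' -> slim b b' -> slim (fun n => a n * b n) (a' * b').
Proof.
move=> ar aa bb v.
apply: (@conv_le _ _ _ _
  (fun n => r * nm (b n v - b' v) + nm (a n (b' v) - a' (b' v)))).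
  move=> n; rewrite !opE -(subrK (a n (b' v)) (a n (b n v))) -addrA.
  apply: le_trans (nmD _ _) _; rewrite lerD2r -linearB; exact: ar.
rewrite -[X in _ --> X]addr0 -[X in _ --> X + _](mulr0 r).
apply: cvgD; last exact: aa.
by apply: cvgM; [exact: cvg_cst|exact: bb].
Qed.

Lemma slimMl a (b : nat -> M) b' : slim b b' -> slim (fun n => a * b n) (a * b').
Proof.
move=> bb; have [r _ ar] := bnd_ex a.
by apply: (@slimM _ _ _ _ r) => //; exact: slim_cst.
Qed.

Lemma slimMr a (b : nat -> M) b' : slim b b' -> slim (fun n => b n * a) (b' * a).
Proof. by move=> bb v; exact: bb. Qed.

Lemma slim_bnd (a : nat -> M) b r : slim a b -> (forall n, bnd (a n) r) -> bnd b r.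
Proof. by move=> ab ar v; apply: conv_nm_le (ab v) _ => n; exact: ar. Qed.

Lemma slim_comm (a : nat -> M) b c : slim a b ->
  (forall n, c * a n = a n * c) -> c * b = b * c.
Proof.
move=> ab ca; apply: slim_unique (slimMl c ab) _.
by under eq_fun do rewrite ca; exact: slimMr.
Qed.

Lemma slim_sa (a : nat -> M) b : slim a b -> (forall n, adj (a n) = a n) ->
  adj b = b.
Proof.
move=> ab sa; apply: adj_uniq => u v.
have c1 := conv_ip (w := v) (ab u); have c2 := conv_ip (w := u) (ab v).
rewrite [RHS]ipC; apply: (cvg_unique _ c1); first exact: norm_hausdorff.
have -> : (fun n => ip (a n u) v) = (fun n => ip (a n v) u).
  by apply/funext => n; rewrite sa_ip// ipC.
exact: c2.
Qed.

(** M is closed under strong limits because it is its own bicommutant. *)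
Lemma strong_limit (a : nat -> M) r : (forall n, bnd (a n) r) ->
  (forall v, exists2 s : nat -> R, (forall n, 0 <= s n) &
     forall n m, (n <= m)%N -> nm (a m v - a n v) ^+ 2 <= s n - s m) ->
  exists b, slim a b.
Proof.
move=> ar cau.
have r0 v : 0 <= r * nm v by exact: le_trans (nm_ge0 _) (ar 0%N v).
have /choice[f fP] : forall v, exists l, conv (fun n => a n v) l.
  by move=> v; have [s s0 as_] := cau v; exact: conv_complete s0 as_.
have [K ge0K rK] : exists2 K, 0 <= K & forall v, r * nm v <= K * nm v.
  by exists `|r| => // v; rewrite ler_wpM2r ?nm_ge0// ler_norm.
have fL : linear f.
  move=> k x y; apply: conv_unique (fP _) _.
  have : conv (fun n => k *: a n x + a n y) (k *: f x + f y).
    have Z := convZ k (fP x).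
    exact: convD Z (fP y).
  by congr conv; apply/funext => n; rewrite linearP.
have fB : f \in bounded_operator H H.
  apply: (@bounded_operatorP _ _ _ _ K%:C) => // [|x].
    by rewrite lecR.
  rewrite !normcE -rmorphM lecR; apply: conv_nm_le (fP x) _ => n.
  exact: le_trans (ar n x) (rK x).
have fM : Bop fB \in vN_pred M.
  rewrite -vN_bicommutant; apply/asboolP => c /asboolP cM; apply: bopP => x /=.
  apply: (conv_unique (fP _)).
  have [s _ cs] := bnd_ex c.
  apply: (@conv_le _ _ _ _ (fun n => s * nm (a n x - f x))).
    move=> n; have /(congr1 (fun g : bop H H => g x)) /= <- := cM _ (valP (a n)).
    by rewrite -linearB; apply: cs.
  by rewrite -(mulr0 s); apply: cvgM => //; [exact: cvg_cst|exact: fP].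
by exists (VNSort fM) => v; exact: fP.
Qed.

End StrongLimits.
(** * Kernel projections and the modulus *)

Section KernelProjections.
Context {R : realType} {H : hilbertSpace R} {M : vonNeumannAlgebra H}.
Implicit Types (u v w : H) (r : R) (a b c x q : M).

(** Membership in the bicommutant of x relative to M. Since x lies in M, its
    elements commute with one another ([bicomm_comm]). *)
Definition bicomm x a := forall c, c * x = x * c -> c * a = a * c.

Lemma bicomm_id x : bicomm x x. Proof. by []. Qed.

Lemma bicomm1 x : bicomm x 1.
Proof. by move=> c _; rewrite mulr1 mul1r. Qed.

Lemma bicommD x a b : bicomm x a -> bicomm x b -> bicomm x (a + b).
Proof. by move=> xa xb c cx; rewrite mulrDr mulrDl xa// xb. Qed.

Lemma bicommN x a : bicomm x a -> bicomm x (- a).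
Proof. by move=> xa c cx; rewrite mulrN mulNr xa. Qed.

Lemma bicommB x a b : bicomm x a -> bicomm x b -> bicomm x (a - b).
Proof. by move=> xa xb; apply: bicommD => //; exact: bicommN. Qed.

Lemma bicommM x a b : bicomm x a -> bicomm x b -> bicomm x (a * b).
Proof. by move=> xa xb c cx; rewrite mulrA xa// -mulrA xb// mulrA. Qed.

Lemma bicommZ x a (k : R[i]) : bicomm x a -> bicomm x (k *: a).
Proof. by move=> xa c cx; rewrite -vN_scalerAr -vN_scalerAl xa. Qed.

Lemma bicommX x a n : bicomm x a -> bicomm x (a ^+ n).
Proof.
move=> xa; elim: n => [|n IH]; first exact: bicomm1.
by rewrite exprS; exact: bicommM.
Qed.

Lemma bicomm_trans x a b : bicomm x a -> bicomm a b -> bicomm x b.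
Proof. by move=> xa ab c cx; apply: ab; exact: xa. Qed.

Lemma bicomm_slim x (a : nat -> M) b : slim a b -> (forall n, bicomm x (a n)) ->
  bicomm x b.
Proof. by move=> ab xa c cx; apply: slim_comm ab _ => n; exact: xa. Qed.

Lemma bicomm_comm x a b : bicomm x a -> bicomm x b -> a * b = b * a.
Proof. by move=> xa xb; apply: xb; symmetry; exact: xa. Qed.

Lemma adjX a n : adj a = a -> adj (a ^+ n) = a ^+ n.
Proof.
move=> sa; elim: n => [|n IH]; first exact: adj1.
by rewrite exprS adjM IH sa -exprSr exprS.
Qed.

(** The powers of c = 1 - s b^2 with 0 <= s b^2 <= 1 decrease strongly to the
    projection on the fixed vectors of c, which are the kernel of b. Being a
    limit of polynomials in b, it stays in the bicommutant of b. *)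
Lemma kernel_projection b : adj b = b -> exists q,
  [/\ adj q = q, q * q = q, b * q = 0, bicomm b q & forall v, b v = 0 -> q v = v].
Proof.
move=> sb; have [r r0 br] := bnd_ex b.
(* This s makes s b^2 <= 1, as r bounds b. *)
pose s : R := (r ^+ 2 + 1)^-1.
have r1 : 0 < r ^+ 2 + 1 by rewrite ltr_wpDl ?sqr_ge0 ?ltr01.
have s0 : 0 < s by rewrite invr_gt0.
have sr : s * r ^+ 2 <= 1 by rewrite mulrC ler_pdivrMr// mul1r lerDl.
pose c : M := 1 - s%:C *: (b * b).
have sc : adj c = c by rewrite adjB adj1 adjZ adjM sb.
have bc : bicomm b c.
  by apply: bicommB; [exact: bicomm1|apply: bicommZ; apply: bicommM; exact: bicomm_id].
pose S n v := ip ((c ^+ n) v) v.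
have SD m n v : ip ((c ^+ m) v) ((c ^+ n) v) = S (m + n)%N v.
  by rewrite /S addnC exprD opME [RHS]sa_ip// adjX.
have S0 v : S 0%N v = nm v ^+ 2 by rewrite /S expr0 op1E ip_nm.
(* Moments of c at v: nonnegative and nonincreasing, they certify the strong
   convergence of the powers of c. *)
have SS n v : S n.+1 v = S n v - s * S n (b v).
  have cE w : c w = w - s%:C *: b (b w) by rewrite /c !opE.
  rewrite /S exprSr opME cE linearB linearZ !ipE; congr (_ - _ * _).
  have cb : c ^+ n * b = b * c ^+ n.
    by symmetry; apply: (bicommX n bc).
  rewrite -[X in ip X v](opME (c ^+ n) b (b v)) cb opME sa_ip //.
have S1 v : 0 <= S 1%N v.
  rewrite SS !S0 subr_ge0.
  have := br v; have := nm_ge0 v; have := nm_ge0 (b v).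
  move=> h1 h2 h3; have : nm (b v) ^+ 2 <= r ^+ 2 * nm v ^+ 2.
    by rewrite -exprMn lerXn2r// nnegrE mulr_ge0.
  have := sqr_ge0 (nm v); nra.
have Sge n v : 0 <= S n v.
  suff: 0 <= S n v /\ 0 <= S n.+1 v by case.
  elim: n v => [|n IH] v; first by rewrite S0 sqr_ge0 S1.
  split; first exact: (IH v).2.
  have -> : S n.+2 v = S n (c v); last exact: (IH _).1.
  by rewrite -addn1 -SD expr1 exprSr opME.
have Sdec v : nonincreasing_seq (S ^~ v).
  apply/nonincreasing_seqP => n; rewrite SS gerBl.
  by apply: mulr_ge0; [exact: ltW|exact: Sge].
have cb1 n : bnd (c ^+ n) 1.
  move=> v; rewrite mul1r -(ler_pXn2r (_ : (0 < 2)%N)) ?nnegrE ?nm_ge0//.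
  by rewrite -ip_nm SD -S0; exact: Sdec.
have [|q cq] := strong_limit cb1.
  move=> v; exists (fun n => S (n + n)%N v) => [n|n m nm']; first exact: Sge.
  rewrite nm_sqB -!ip_nm !SD.
  have := Sdec v (m + n)%N (m + m)%N; rewrite leq_add2l => /(_ nm').
  lra.
have cqq : c * q = q.
  apply: slim_unique (slimMl c cq) _ => v; have := conv_shift 1 (cq v).
  by under eq_fun do rewrite addn1 exprS.
have cnq n : c ^+ n * q = q.
  by elim: n => [|n IH]; rewrite ?mul1r// exprSr -mulrA cqq.
have sq : adj q = q by apply: slim_sa cq _ => n; exact: adjX.
exists q; split=> //.
- apply: slim_unique (slimMr q cq) _.
  by under eq_fun do rewrite cnq; exact: slim_cst.
- apply: adj_mul_eq0; rewrite adjM sq sb -mulrA (mulrA b).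
  have /eqP : c * q = q by [].
  rewrite mulrBl mul1r -vN_scalerAl -subr_eq0 addrAC subrr sub0r oppr_eq0.
  rewrite scaler_eq0 => /orP[/eqP/complexI s00|/eqP ->]; last by rewrite mulr0.
  by rewrite s00 ltxx in s0.
- by apply: bicomm_slim cq _ => n; exact: bicommX.
- move=> v bv; have cv : c v = v by rewrite !opE bv linear0 scaler0 subr0.
  have cnv n : (c ^+ n) v = v.
    by elim: n => [|n IH]; rewrite ?op1E// exprS opME IH.
  apply: conv_unique (cq v) _.
  by under eq_fun do rewrite cnv; exact: conv_cst.
Qed.

(** The square root of x^2 is 1 - z, where z solves 2 z = (1 - x^2) + z^2 and is
    the limit of the iteration z -> ((1 - x^2) + z^2) / 2 from 0. The same
    iteration on scalars, t -> (1 + t^2) / 2, increases within [0, 1] and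
    dominates the increments of the operator iteration. *)
Lemma contractive_abs x : adj x = x -> bnd x 1 -> exists s,
  [/\ adj s = s, s * s = x * x, bicomm x s & forall v, 0 <= ip (s v) v].
Proof.
move=> sx x1.
pose b : M := 1 - x * x.
have sb : adj b = b by rewrite adjB adj1 adjM sx.
have xb : bicomm x b.
  by apply: bicommB; [exact: bicomm1|apply: bicommM; exact: bicomm_id].
have b1 : bnd b 1.
  move=> v; rewrite mul1r -(ler_pXn2r (_ : (0 < 2)%N)) ?nnegrE ?nm_ge0//.
  rewrite !opE nm_sqB ipC sa_ip// ip_nm.
  have := x1 (x v); rewrite mul1r => xx.
  have := nm_ge0 (x (x v)); have := nm_ge0 (x v); nra.
pose h : R[i] := (2^-1)%:C.
pose z n := iter n (fun z : M => h *: (b + z * z)) 0.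
pose t n := iter n (fun t : R => (1 + t ^+ 2) / 2) 0.
have zS n : z n.+1 = h *: (b + z n * z n) by [].
have tS n : t n.+1 = (1 + t n ^+ 2) / 2 by [].
have sz n : adj (z n) = z n.
  elim: n => [|n IH]; first exact: adj0.
  by rewrite zS adjZ adjD adjM IH sb.
have xz n : bicomm x (z n).
  elim: n => [|n IH]; first by move=> d _; rewrite mulr0 mul0r.
  by rewrite zS; apply/bicommZ/bicommD => //; exact: bicommM.
have t01 n : 0 <= t n <= 1.
  by elim: n => [|n /andP[IH1 IH2]]; rewrite ?lexx ?ler01// tS; nra.
have tinc : nondecreasing_seq t.
  apply/nondecreasing_seqP; elim=> [|n IH]; first by have /andP[] := t01 1%N.
  have /andP[h1 h2] := t01 n; have /andP[h3 h4] := t01 n.+1.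
  by rewrite (tS n) (tS n.+1); nra.
have hZ (a : M) r : bnd a r -> bnd (h *: a) (r / 2).
  by move=> ar; rewrite mulrC; have := bndZ 2^-1 ar; rewrite ger0_norm.
have zt n : bnd (z n) (t n).
  elim: n => [|n IH]; first by move=> v; rewrite op0E nm0 mul0r.
  rewrite zS tS; apply/hZ/bndD => //; rewrite expr2; apply: bndM => //.
  by have /andP[] := t01 n.
have zz n : bnd (z n.+1 - z n) (t n.+1 - t n).
  elim: n => [|n IH].
    rewrite subr0; have -> : t 0%N = 0 by []; rewrite subr0; exact: zt.
  have -> : z n.+2 - z n.+1 = h *: ((z n.+1 + z n) * (z n.+1 - z n)).
    rewrite (zS n.+1) [in X in _ - X](zS n) -scalerBr opprD addrACA subrr add0r.
    by rewrite mulrDl !mulrBr (bicomm_comm (xz n) (xz n.+1)) addrA subrK.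
  have -> : t n.+2 - t n.+1 = (t n.+1 + t n) * (t n.+1 - t n) / 2.
    by rewrite (tS n.+1) [in X in _ - X](tS n); field.
  apply/hZ/bndM => //; last exact: bndD.
  by have /andP[? _] := t01 n; have /andP[? _] := t01 n.+1; rewrite addr_ge0.
have zmn m n : (n <= m)%N -> bnd (z m - z n) (t m - t n).
  move=> /subnK <-; elim: (m - n)%N => [|k IH].
    by move=> v; rewrite !subrr op0E nm0 mul0r.
  have -> : z (k.+1 + n)%N - z n = (z (k + n).+1 - z (k + n)%N) + (z (k + n)%N - z n).
    by rewrite addrA subrK.
  have -> : t (k.+1 + n)%N - t n = (t (k + n).+1 - t (k + n)%N) + (t (k + n)%N - t n).
    by rewrite addrA subrK.
  exact: bndD.
have [||y zy] := @strong_limit _ _ _ z 1.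
- by move=> n; apply: bnd_le (zt n); have /andP[] := t01 n.
- move=> v; exists (fun n => (1 - t n) * nm v ^+ 2) => [n|n m nm'].
    by rewrite mulr_ge0 ?sqr_ge0// subr_ge0; have /andP[] := t01 n.
  have := zmn _ _ nm' v; have := nm_ge0 ((z m - z n) v); rewrite !opE.
  have /andP[h1 h2] := t01 n; have /andP[h3 h4] := t01 m; have := tinc _ _ nm'.
  have := nm_ge0 v; set A := nm _; set B := nm _ => A0 tmn B0 BA.
  have : B ^+ 2 <= ((t m - t n) * A) ^+ 2.
    by rewrite lerXn2r// nnegrE mulr_ge0// subr_ge0.
  have : (t m - t n) ^+ 2 <= t m - t n by nra.
  have := sqr_ge0 A; rewrite exprMn; nra.
have sy : adj y = y by exact: slim_sa zy sz.
have y1 : bnd y 1.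
  by apply: slim_bnd zy _ => n; apply: bnd_le (zt n); have /andP[] := t01 n.
have yE : y + y = b + y * y.
  have e : y = h *: (b + y * y).
    have z1 : slim (fun n => z n.+1) y.
      move=> v; have := conv_shift 1 (zy v).
      by under eq_fun do rewrite addn1.
    apply: slim_unique z1 _.
    have z2 : slim (fun n => b + z n * z n) (b + y * y).
      apply: slimD; first exact: slim_cst.
      apply: (@slimM _ _ _ _ _ _ _ 1) => // n.
      by apply: bnd_le (zt n); have /andP[] := t01 n.
    have Z := slimZ h z2; exact: Z.
  by rewrite {1 2}e -scalerDl /h -rmorphD (_ : 2^-1 + 2^-1 = 1) ?scale1r//; lra.
exists (1 - y); split.
- by rewrite adjB adj1 sy.
- rewrite mulrBl mul1r mulrBr mulr1 opprB addrACA -opprD yE opprD addrACA subrr.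
  by rewrite addr0 /b subKr.
- by apply: bicommB; [exact: bicomm1|exact: bicomm_slim zy xz].
- move=> v; rewrite !opE !ipE ip_nm subr_ge0.
  apply: le_trans (ip_CS _ _) _; have := y1 v; rewrite mul1r => yv.
  by rewrite expr2 ler_wpM2r ?nm_ge0.
Qed.

End KernelProjections.
(** * Splitting the spectrum of a self-adjoint operator *)

Section SpectralBisection.
Context {R : realType} {H : hilbertSpace R} {M : vonNeumannAlgebra H}.
Implicit Types (u v w : H) (r : R) (a b c x q e f : M).

Lemma abs_ex x : adj x = x -> exists s,
  [/\ adj s = s, s * s = x * x, bicomm x s & forall v, 0 <= ip (s v) v].
Proof.
move=> sx; have [r r0 xr] := bnd_ex x.
pose k : R := r + 1.
have k0 : 0 < k by rewrite ltr_wpDl.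
have kk : k^-1 * k = 1 by rewrite mulVf// gt_eqF.
have k1 : `|k^-1| = k^-1 by rewrite ger0_norm// invr_ge0 ltW.
have [||s [ss s2 xs s0]] := @contractive_abs _ _ _ (k^-1%:C *: x).
- by rewrite adjZ sx.
- move=> v; rewrite mul1r opZE nmZ k1 ler_pdivrMl//.
  apply: le_trans (xr v) _; rewrite ler_wpM2r ?nm_ge0// /k; lra.
exists (k%:C *: s); split.
- by rewrite adjZ ss.
- rewrite -vN_scalerAl -vN_scalerAr s2 -vN_scalerAl -vN_scalerAr !scalerA.
  rewrite -!rmorphM (_ : k * k * k^-1 * k^-1 = 1) ?scale1r//.
  by field; rewrite gt_eqF.
- apply: bicommZ; apply: bicomm_trans xs; apply: bicommZ; exact: bicomm_id.
- by move=> v; rewrite opZE ipZl mulr_ge0// ltW.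
Qed.

Lemma proj_ip q u : adj q = q -> q * q = q -> ip (q u) u = nm (q u) ^+ 2.
Proof. by move=> sq qq; rewrite -ip_nm [RHS]sa_ip// -opME qq sa_ip. Qed.

Lemma proj_pyth q u : adj q = q -> q * q = q ->
  nm u ^+ 2 = nm (q u) ^+ 2 + nm (u - q u) ^+ 2.
Proof.
move=> sq qq; rewrite nm_sqB ipC proj_ip//; ring.
Qed.

Lemma proj_bnd q : adj q = q -> q * q = q -> bnd q 1.
Proof.
move=> sq qq v; rewrite mul1r -(ler_pXn2r (_ : (0 < 2)%N)) ?nnegrE ?nm_ge0//.
by rewrite (proj_pyth v sq qq) lerDl sqr_ge0.
Qed.

(** With q the projection onto the kernel of |x| + x, one has
    x = |x| (1 - 2 q), and 0 <= |x| <= r puts |x| within r / 2 of the scalar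
    r / 2. So x is within r / 2 of r / 2 on the range of 1 - q and of - r / 2 on
    the range of q. *)
Lemma symmetry_approx x r : adj x = x -> 0 <= r -> bnd x r -> exists q,
  [/\ adj q = q, q * q = q, bicomm x q &
      bnd (x - (r / 2)%:C *: (1 - (q + q))) (r / 2)].
Proof.
move=> sx r0 xr; have [s [ss s2 xs s0]] := abs_ex sx.
have xx : bicomm x x by [].

have sr : bnd s r.
  move=> v; suff -> : nm (s v) = nm (x v) by exact: xr.
  apply/eqP; rewrite -(eqrXn2 (_ : (0 < 2)%N)) ?nm_ge0//; apply/eqP.
  by rewrite -!ip_nm !sa_ip// -!opME s2.
(* |x| + x is twice the positive part of x; (|x| + x) (|x| - x) = 0. *)
have [|q [sq qq bq bqc qv]] := @kernel_projection _ _ _ (s + x).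
  by rewrite adjD ss sx.
have xq : bicomm x q by apply: bicomm_trans bqc; exact: bicommD.
exists q; split=> //.
have sxq : s * q + x * q = 0 by rewrite -mulrDl.
have qsx : q * (s - x) = s - x.
  apply: opP => v; rewrite opME; apply: qv; rewrite -opME.
  have -> : (s + x) * (s - x) = 0; last by [].
  by rewrite mulrDl !mulrBr s2 (bicomm_comm xx xs) addrA subrK subrr.
pose u : M := 1 - (q + q).
have xsu : x = s * u.
  have e1 : x = s - (s * q - x * q).
    by rewrite -mulrBl (bicomm_comm (bicommB xs xx) xq) qsx subKr.
  have e2 : x * q = - (s * q) by apply/eqP; rewrite -addr_eq0 addrC sxq.
  by rewrite {1}e1 e2 opprK /u mulrBr mulr1 mulrDr.
pose k : M := (r / 2)%:C *: (1 : M).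
have -> : x - (r / 2)%:C *: (1 - (q + q)) = (s - k) * u.
  by rewrite mulrBl -xsu -vN_scalerAl mul1r.
have su : adj u = u by rewrite adjB adj1 adjD sq.
have uu : u * u = 1.
  have pp : (q + q) - (q + q) * (q + q) = - (q + q).
    by rewrite mulrDl !mulrDr !qq opprD addrA subrr sub0r.
  by rewrite /u mulrBl mul1r mulrBr mulr1 pp opprK subrK.
have u1 : bnd u 1.
  move=> v; rewrite mul1r -(ler_pXn2r (_ : (0 < 2)%N)) ?nnegrE ?nm_ge0//.
  by rewrite -!ip_nm sa_ip// -opME uu op1E.
rewrite -[X in bnd _ X]mulr1; apply: bndM => //; first by rewrite divr_ge0.
move=> v; rewrite -(ler_pXn2r (_ : (0 < 2)%N)) ?nnegrE ?nm_ge0//; last first.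
  by rewrite mulr_ge0 ?nm_ge0 ?divr_ge0.
rewrite !opE nm_sqB nmZ ger0_norm ?divr_ge0// ipZr.
(* s^2 <= r s: expand the positivity of s at the vector r v - s v. *)
have main : nm (s v) ^+ 2 <= r * ip (s v) v.
  have [r00|rn0] := eqVneq r 0.
    have := sr v; rewrite r00 !mul0r => h.
    by rewrite -(mul0r 0) expr2 ler_pM ?nm_ge0.
  have rp : 0 < r by rewrite lt_def rn0.
  have := s0 (r%:C *: v - s v); rewrite linearB linearZ /= !ipE.
  rewrite (sa_ip (s v) v ss) ip_nm.
  have : ip (s (s v)) (s v) <= r * nm (s v) ^+ 2.
    apply: le_trans (ip_CS _ _) _; rewrite expr2 mulrA ler_wpM2r ?nm_ge0//.
  by move=> h1 h2; rewrite -(ler_pM2l rp); nra.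
rewrite exprMn; lra.
Qed.

End SpectralBisection.
(** * Vanishing of maps compatible with projections *)

Section GlidingHump.
Context {R : realType} {H : hilbertSpace R} {M : vonNeumannAlgebra H}.
Implicit Types (u v w y : H) (c r : R) (a b x q e f : M).

(** Equivalent to [projection] ([projectionP]), with [adj] in place of the
    relation [is_adjoint]. *)
Definition isproj q := adj q = q /\ q * q = q.

(** Split the range of f at the midpoint c of the spectral interval, and keep the
    half that carries more of f y: by Pythagoras it has at least half of the
    squared norm. *)
Lemma bisect x f c r y : adj x = x -> isproj f -> bicomm x f -> 0 <= r ->
  (forall w, f w = w -> nm (x w - c%:C *: w) <= r * nm w) ->
  exists f' (c' : R), [/\ isproj f', bicomm x f', f' * f = f',
    (forall w, f' w = w -> nm (x w - c'%:C *: w) <= r / 2 * nm w) &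
    nm (f y) ^+ 2 <= 2 * nm (f' y) ^+ 2].
Proof.
move=> sx [sf ff] xf r0 fr.
have xx : bicomm x x by [].
pose X : M := (x - c%:C *: (1 : M)) * f.
have xX : bicomm x X.
  by apply: bicommM => //; apply: bicommB => //; apply/bicommZ/bicomm1.
have XE v : X v = x (f v) - c%:C *: f v by [].
have sX : adj X = X.
  rewrite /X adjM adjB adjZ adj1 sf sx; apply: bicomm_comm xf _.
  by apply: bicommB => //; apply/bicommZ/bicomm1.
have Xr : bnd X r.
  move=> v; rewrite XE; apply: le_trans (fr _ _) _; first by rewrite -opME ff.
  by rewrite ler_wpM2l// -[leRHS]mul1r; exact: proj_bnd.
clearbody X; have [q [sq qq Xq Xb]] := symmetry_approx sX r0 Xr.
have xq : bicomm x q by exact: bicomm_trans xX Xq.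
have fq : f * q = q * f by exact: bicomm_comm xf xq.
have pyth : nm (f y) ^+ 2 = nm ((f * q) y) ^+ 2 + nm ((f * (1 - q)) y) ^+ 2.
  by rewrite (proj_pyth (f y) sq qq) mulrBr mulr1 fq.
have r20 : 0 <= r / 2 by rewrite divr_ge0.
have halfZ w : (r / 2)%:C *: (w + w) = r%:C *: w.
  by rewrite scalerDr -scalerDl -rmorphD -splitr.
have [le|lt] := lerP (nm ((f * (1 - q)) y) ^+ 2) (nm ((f * q) y) ^+ 2).
  exists (f * q), (c - r / 2); split.
  - by split; [rewrite adjM sf sq fq|rewrite mulrA -(mulrA f) -fq mulrA ff -mulrA qq].
  - exact: bicommM.
  - by rewrite fq -mulrA ff.
  - move=> w fqw.
    have fw : f w = w by rewrite -[in LHS]fqw -opME mulrA ff.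
    have qw : q w = w by rewrite -[in LHS]fqw -opME fq mulrA qq -fq.
    apply: le_trans (Xb w); rewrite !opE XE fw qw.
    rewrite opprD addrA subrr sub0r scalerN opprK rmorphB scalerBl opprB.
    by rewrite addrA addrAC.
  - rewrite pyth; lra.
exists (f * (1 - q)), (c + r / 2).
have f1q : f * (1 - q) = (1 - q) * f by rewrite mulrBr mulrBl mul1r mulr1 fq.
have q1q : (1 - q) * (1 - q) = 1 - q.
  by rewrite mulrBr mulr1 mulrBl mul1r qq subrr subr0.
have s1q : adj (1 - q) = 1 - q by rewrite adjB adj1 sq.
split.
- by split; [rewrite adjM sf s1q f1q|rewrite mulrA -(mulrA f) -f1q mulrA ff -mulrA q1q].
- by apply: bicommM => //; apply: bicommB => //; exact: bicomm1.
- by rewrite f1q -mulrA ff.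
- move=> w fqw.
  have fw : f w = w by rewrite -[in LHS]fqw -opME mulrA ff.
  have qw : q w = 0.
    rewrite -[in LHS]fqw -!opME f1q mulrA mulrBr mulr1 qq subrr mul0r.
    by [].
  apply: le_trans (Xb w); rewrite !opE XE fw qw addr0 subr0.
  by rewrite rmorphD scalerDl opprD addrA.
- rewrite pyth; lra.
Qed.

Lemma le_of_eq (r s : R) : r = s -> r <= s.
Proof. by move=> ->. Qed.

Lemma nested_bisection x y : adj x = x -> exists2 r : R, 0 <= r &
  exists (f : nat -> M) (c : nat -> R), forall n,
  [/\ isproj (f n), bicomm x (f n), f n.+1 * f n = f n.+1,
    (forall w, f n w = w -> nm (x w - (c n)%:C *: w) <= r / 2 ^+ n * nm w) &
    nm y ^+ 2 <= 2 ^+ n * nm (f n y) ^+ 2].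
Proof.
move=> sx; have [r r0 xr] := bnd_ex x; exists r => //.
pose P n (s : M * R) := [/\ isproj s.1, bicomm x s.1,
  (forall w, s.1 w = w -> nm (x w - s.2%:C *: w) <= r / 2 ^+ n * nm w) &
    nm y ^+ 2 <= 2 ^+ n * nm (s.1 y) ^+ 2].
have step (ns : nat * (M * R)) : exists s' : M * R,
    P ns.1 ns.2 -> P ns.1.+1 s' /\ s'.1 * ns.2.1 = s'.1.
  case: ns => n [f c] /=.
  have [|nP] := pselect (P n (f, c)); last by exists (f, c).
  move=> [/= pf xf fr fy].
  have r2 : 0 <= r / 2 ^+ n by rewrite divr_ge0// exprn_ge0.
  have [f' [c' [pf' xf' ff fr' fy']]] := bisect y sx pf xf r2 fr.
  exists (f', c') => _; split=> //; split=> //=.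
    by move=> w /fr'; rewrite (exprSr 2 n) invfM mulrA.
  rewrite (exprSr 2 n) -mulrA; apply: le_trans fy _.
  by rewrite ler_wpM2l// exprn_ge0.
have [F FP] := choice step.
pose st n := iteri n (fun n s => F (n, s)) (1 : M, 0 : R).
have stP n : P n (st n).
  elim: n => [|n IH]; last exact: (FP (n, st n) IH).1.
  split=> /=.
  - by split; rewrite ?adj1 ?mulr1.
  - exact: bicomm1.
  - by move=> w _; rewrite scale0r subr0 expr0 divr1.
  - by rewrite expr0 mul1r.
exists (fun n => (st n).1), (fun n => (st n).2) => n.
have [h1 h2 h3 h4] := stP n; split=> //.
exact: (FP (n, st n) (stP n)).2.
Qed.

Section NestedProjections.
Context (f : nat -> M) (pf : forall n, isproj (f n))
  (ff : forall n, f n.+1 * f n = f n.+1).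

Lemma nested_mulr n m : (n <= m)%N -> f m * f n = f m.
Proof.
move=> /subnK <-; elim: (m - n)%N => [|k IH]; first exact: (pf n).2.
by rewrite addSn -ff -mulrA IH.
Qed.

Lemma nested_mull n m : (n <= m)%N -> f n * f m = f m.
Proof.
move=> nm'; rewrite -(pf n).1 -[in LHS](pf m).1 -adjM nested_mulr//.
exact: (pf m).1.
Qed.

Lemma nested_limit x : (forall n, bicomm x (f n)) -> exists q,
  [/\ isproj q, bicomm x q, (forall n, f n * q = q) & slim f q].
Proof.
move=> xf.
have f1 n : bnd (f n) 1 by have [? ?] := pf n; exact: proj_bnd.
have [v|q fq] := strong_limit f1.
  exists (fun n => nm (f n v) ^+ 2) => [n|n m nm']; first exact: sqr_ge0.
  have [sm mm] := pf m; have := proj_pyth (f n v) sm mm.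
  rewrite -opME nested_mulr// nm_distC; lra.
exists q; split=> //.
- split; first by apply: slim_sa fq _ => n; exact: (pf n).1.
  apply: slim_unique (slimM f1 fq fq) _.
  have -> : (fun n => f n * f n) = f; last by [].
  by apply/funext => n; exact: (pf n).2.
- exact: bicomm_slim fq xf.
- move=> n; have s1 : slim (fun m => f (m + n)%N) q.
    by move=> v; exact: conv_shift (fq v).
  apply: slim_unique (slimMl (f n) s1) _.
  have -> : (fun m => f n * f (m + n)%N) = (fun m => f (m + n)%N); last by [].
  by apply/funext => m; rewrite nested_mull// leq_addl.
Qed.

End NestedProjections.
(** The element g = sum_n (3/2)^n d_n (x - c_n) with d_n = f_n - f_(n+1). The
    d_n are mutually orthogonal, so d_n g is the n-th term of the series; the terms are
    of size at most r (3/4)^n, because d_n is below f_n. *)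
Lemma gliding_sum x (f : nat -> M) (c : nat -> R) r :
  (forall n, isproj (f n)) -> (forall n, bicomm x (f n)) ->
  (forall n, f n.+1 * f n = f n.+1) -> 0 <= r ->
  (forall n w, f n w = w -> nm (x w - (c n)%:C *: w) <= r / 2 ^+ n * nm w) ->
  exists2 g, bicomm x g & forall n, (f n - f n.+1) * g =
    ((3 / 2) ^+ n)%:C *: ((f n - f n.+1) * (x - (c n)%:C *: (1 : M))).
Proof.
move=> pf xf ff r0 fr.
have xx : bicomm x x by [].
pose d n := f n - f n.+1.
have xd n : bicomm x (d n) by exact: bicommB.
have fd n : f n * d n = d n.
  by rewrite mulrBr (pf n).2 (nested_mull pf ff)// leqnSn.
have dd n : d n * d n = d n.
  by rewrite {1}/d mulrBl fd mulrBr ff (pf n.+1).2 subrr subr0.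
have d1 n : bnd (d n) 1.
  by apply: proj_bnd => //; rewrite adjB !(pf _).1.
have ddlt n m : (n < m)%N -> d n * d m = 0.
  move=> nm'; rewrite mulrBl !mulrBr.
  by rewrite !(nested_mull pf ff) ?subrr// ltnW// ltnW.
have dd0 n m : n != m -> d n * d m = 0.
  rewrite neq_ltn => /orP[|] /ddlt // h; rewrite (bicomm_comm (xd n) (xd m)) //.
pose X n := x - (c n)%:C *: (1 : M).
have xX n : bicomm x (X n) by apply: bicommB => //; apply/bicommZ/bicomm1.
pose t n := ((3 / 2) ^+ n)%:C *: (d n * X n).
have xt n : bicomm x (t n) by apply/bicommZ/bicommM.
have tb n : bnd (t n) (r * (3 / 4) ^+ n).
  have -> : r * (3 / 4) ^+ n = `|(3 / 2) ^+ n| * (r / 2 ^+ n).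
    rewrite ger0_norm ?exprn_ge0// mulrCA -exprVn -exprMn; congr (_ * _ ^+ n).
    by field.
  apply: bndZ => v; rewrite (bicomm_comm (xd n) (xX n)).
  have XE w : (X n) w = x w - (c n)%:C *: w by [].
  rewrite opME XE; apply: le_trans (fr n _ _) _; first by rewrite -opME fd.
  rewrite ler_wpM2l ?divr_ge0 ?exprn_ge0//.
  by have := d1 n v; rewrite mul1r.
pose g n := \sum_(k < n) t k.
have gS n : g n.+1 = t n + g n by rewrite /g big_ord_recr /= addrC.
(* The tails of the geometric series that bounds the terms. *)
pose s n : R := 4 * r * (3 / 4) ^+ n.
have sS n : r * (3 / 4) ^+ n = s n - s n.+1 by rewrite /s exprS; field.
have gb m n : (n <= m)%N -> bnd (g m - g n) (s n - s m).
  move=> /subnK <-; elim: (m - n)%N => [|k IH].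
    by move=> v; rewrite !subrr op0E nm0 mul0r.
  have -> : g (k.+1 + n)%N - g n = t (k + n)%N + (g (k + n)%N - g n).
    by rewrite addSn gS addrA.
  have -> : s n - s (k.+1 + n)%N = r * (3 / 4) ^+ (k + n) + (s n - s (k + n)%N).
    by rewrite sS addSn; ring.
  exact: bndD.
have s0 n : 0 <= s n by rewrite /s !mulr_ge0// exprn_ge0.
have sdec n m : (n <= m)%N -> s m <= s n.
  move=> nm'; rewrite /s ler_wpM2l ?mulr_ge0//.
  by apply: ler_wiXn2l => //; lra.
have g0 n : bnd (g n) (s 0%N).
  have : bnd (g n - g 0%N) (s 0%N - s n) by exact: gb.
  have -> : g 0%N = 0 by rewrite /g big_ord0.
  by rewrite subr0; apply: bnd_le; rewrite gerBl.
have [v|G gG] := strong_limit g0.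
  exists (fun n => s 0%N * nm v ^+ 2 * s n) => [n|n m nm'].
    by apply: mulr_ge0; [apply: mulr_ge0; rewrite ?s0 ?sqr_ge0|exact: s0].
  have := gb _ _ nm' v; rewrite opDE opNE => h.
  have h0 := nm_ge0 (g m v - g n v).
  have h1 : nm (g m v - g n v) ^+ 2 <= ((s n - s m) * nm v) ^+ 2.
    by rewrite lerXn2r// nnegrE mulr_ge0 ?nm_ge0// subr_ge0 sdec.
  have h2 : (s n - s m) ^+ 2 <= s 0%N * (s n - s m).
    have := sdec _ _ nm'; have := sdec _ _ (leq0n n); have := s0 m; nra.
  have h3 := ler_wpM2r (sqr_ge0 (nm v)) h2.
  apply: le_trans h1 _; rewrite exprMn; apply: le_trans h3 _.
  by apply: le_of_eq; ring.
exists G.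
  apply: bicomm_slim gG _ => n; elim: n => [|n IH]; last first.
    by rewrite gS; exact: bicommD.
  by move=> e _; rewrite /g big_ord0 mulr0 mul0r.
move=> n; rewrite -/(d n) -/(X n) -/(t n).
have dt k : d n * t k = if k == n then t n else 0.
  rewrite /t -vN_scalerAr mulrA.
  by case: eqVneq => [->|kn]; rewrite ?dd// dd0 1?eq_sym// mul0r scaler0.
have dg m : (n < m)%N -> d n * g m = t n.
  elim: m => // m IH; rewrite ltnS leq_eqVlt gS mulrDr dt => /orP[/eqP <-|nm'].
    rewrite eqxx mulr_sumr big1 ?addr0// => k _.
    by rewrite dt ltn_eqF.
  by rewrite gtn_eqF// add0r IH.
have s1 : slim (fun m => g (m + n.+1)%N) G by move=> v; exact: conv_shift (gG v).
apply: slim_unique (slimMl (d n) s1) _.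
have -> : (fun m => d n * g (m + n.+1)%N) = (fun=> t n); last exact: slim_cst.
by apply/funext => m; rewrite dg// ltn_addl.
Qed.

(** The c_n converge to the Rayleigh quotient of x at any nonzero vector of the
    range of q. *)
Lemma nested_limit_eigen x (f : nat -> M) (c : nat -> R) r q :
  (forall n w, f n w = w -> nm (x w - (c n)%:C *: w) <= r / 2 ^+ n * nm w) ->
  (forall n, f n * q = q) -> exists k : R, x * q = k%:C *: q.
Proof.
move=> fr fq.
have fqv n v : f n (q v) = q v by rewrite -opME fq.
have [[v0 qv0]|q0] := pselect (exists v, q v <> 0); last first.
  exists 0; rewrite scale0r; apply: opP => v; rewrite opME op0E.
  have [->|qv] := eqVneq (q v) 0; first by rewrite linear0.
  by case: q0; exists v; exact/eqP.
set w0 := q v0 in qv0.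
have w0p : 0 < nm w0 ^+ 2.
  by rewrite exprn_gt0// lt_def nm_ge0 andbT; apply/eqP => /nm_eq0.
pose k : R := ip (x w0) w0 / nm w0 ^+ 2.
have ck n : `|c n - k| <= r / 2 ^+ n.
  have kE : (k - c n) * nm w0 ^+ 2 = ip (x w0 - (c n)%:C *: w0) w0.
    by rewrite ipDl ipNl ipZl ip_nm mulrBl divfK// gt_eqF.
  have h := fr n _ (fqv n v0); rewrite -/w0 in h.
  have h' : nm (x w0 - (c n)%:C *: w0) * nm w0 <= r / 2 ^+ n * nm w0 ^+ 2.
    by rewrite expr2 mulrA ler_wpM2r ?nm_ge0.
  rewrite -(ler_pM2r w0p) -[X in `|_| * X](gtr0_norm w0p) -normrM.
  rewrite -(opprB k) mulNr kE normrN ler_norml.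
  rewrite (le_trans (ip_CS _ _) h') andbT lerNl -ipNl.
  by apply: le_trans (ip_CS _ _) _; rewrite nmN.
exists k; apply: opP => v; rewrite opME opZE; apply/subr0_eq/nm_eq0/eqP.
rewrite eq_le nm_ge0 andbT; set w := q v.
have kw n : nm (x w - k%:C *: w) <= 2 * r * nm w * (2^-1) ^+ n.
  have -> : x w - k%:C *: w = (x w - (c n)%:C *: w) + (c n - k)%:C *: w.
    by rewrite rmorphB scalerBl addrA subrK.
  apply: le_trans (nmD _ _) _; rewrite nmZ.
  apply: le_trans (lerD (fr n _ (fqv n v)) (ler_wpM2r (nm_ge0 _) (ck n))) _.
  by apply: le_of_eq; rewrite exprVn; ring.
have lim0 : (fun n => 2 * r * nm w * (2^-1) ^+ n) @ \oo --> (2 * r * nm w * 0).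
  apply: cvgM; first exact: cvg_cst.
  by apply: cvg_expr; rewrite ger0_norm; lra.
rewrite mulr0 in lim0; apply: (cvgr_to_ge lim0).
exact: nearW.
Qed.

(** The gliding hump: phi has a value at g, and d_n (phi g) = (3/2)^n d_n y
    bounds d_n y by a multiple of (2/3)^n. *)
Lemma projection_module_vanish x (phi : M -> H) : adj x = x ->
  (forall a b, phi (a + b) = phi a + phi b) ->
  (forall c a, phi (c%:C *: a) = c%:C *: phi a) ->
  phi 1 = 0 ->
  (forall e a, isproj e -> bicomm x e -> bicomm x a -> phi (e * a) = e (phi a)) ->
  phi x = 0.
Proof.
move=> sx phiD phiZ phi1 phiM; set y := phi x.
have xx : bicomm x x by [].
have [r r0 [f [c fcP]]] := nested_bisection y sx.
have pf n : isproj (f n) by case: (fcP n).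
have xf n : bicomm x (f n) by case: (fcP n).
have ff n : f n.+1 * f n = f n.+1 by case: (fcP n).
have fr n w : f n w = w -> nm (x w - (c n)%:C *: w) <= r / 2 ^+ n * nm w.
  by case: (fcP n) => _ _ _ h _; exact: h.
have fy n : nm y ^+ 2 <= 2 ^+ n * nm (f n y) ^+ 2 by case: (fcP n).
have [q [pq xq fq slq]] := nested_limit pf ff xf.
have [g xg gE] := gliding_sum pf xf ff r0 fr.
pose d n := f n - f n.+1.
have pd n : isproj (d n).
  split; first by rewrite adjB !(pf _).1.
  rewrite {1}/d mulrBl !mulrBr (pf n).2 (pf n.+1).2 ff (nested_mull pf ff)//.
  by rewrite subrr subr0.
have xd n : bicomm x (d n) by exact: bicommB.
have phiX (k : R) : phi (x - k%:C *: (1 : M)) = y.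
  by rewrite -scaleNr -rmorphN phiD phiZ phi1 scaler0 addr0.
have xX (k : R) : bicomm x (x - k%:C *: (1 : M)).
  by apply: bicommB => //; apply/bicommZ/bicomm1.
have dy n : (3 / 2) ^+ n * nm (d n y) <= nm (phi g).
  have <- : nm (d n (phi g)) = (3 / 2) ^+ n * nm (d n y).
    rewrite -phiM// gE phiZ. rewrite phiM//; [rewrite [phi _](phiX (c n)) nmZ ger0_norm// exprn_ge0//|exact: pd|exact: xd].
  rewrite -[leRHS]mul1r; have [h1 h2] := pd n; exact: proj_bnd.
(* On the range of q the operator x is a scalar k, and phi (k q) = k q (phi 1). *)
have qy : q y = 0.
  have [k xqk] := nested_limit_eigen fr fq.
  rewrite -phiM// (bicomm_comm xq xx) xqk phiZ -(mulr1 q) phiM//.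
    by rewrite phi1 linear0 scaler0.
  exact: bicomm1.
pose B := nm (phi g).
have B0 : 0 <= B by exact: nm_ge0.
have dy' n : nm (d n y) <= B * (2 / 3) ^+ n.
  rewrite -[leRHS]mulr1 -(ler_pM2l (_ : 0 < (3 / 2) ^+ n)) ?exprn_gt0//.
  apply: le_trans (dy n) _; rewrite mulr1 mulrCA -exprMn.
  by rewrite (_ : 3 / 2 * (2 / 3) = 1) ?expr1n ?mulr1//; field.
have fm n m : nm (f n y - f (m + n)%N y) <= 3 * B * (2 / 3) ^+ n.
  suff : nm (f n y - f (m + n)%N y) <= 3 * B * ((2 / 3) ^+ n - (2 / 3) ^+ (m + n)).
    by move/le_trans; apply; rewrite ler_wpM2l ?mulr_ge0// gerBl exprn_ge0//.
  elim: m => [|m IH]; first by rewrite !subrr nm0 mulr0.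
  rewrite -(subrK (f (m + n)%N y) (f n y)) -addrA.
  apply: le_trans (nmD _ _) _.
  have := dy' (m + n)%N; rewrite opDE opNE => h.
  apply: le_trans (lerD IH h) _.
  by rewrite addSn [in leRHS]exprS; apply: le_of_eq; field.
have fyn n : nm (f n y) <= 3 * B * (2 / 3) ^+ n.
  have cq : conv (fun m => f n y - f (m + n)%N y) (f n y - q y).
    apply: convD; first exact: conv_cst.
    by apply: convN; exact: conv_shift (slq y).
  by rewrite -(subr0 (f n y)) -qy; exact: conv_nm_le cq (fm n).
(* 2^n comes from the n bisections, and 2 (2/3)^2 = 8/9 < 1. *)
have yn n : nm y ^+ 2 <= (3 * B) ^+ 2 * (8 / 9) ^+ n.
  apply: le_trans (fy n) _.
  apply: (@le_trans _ _ (2 ^+ n * (3 * B * (2 / 3) ^+ n) ^+ 2)).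
    rewrite ler_wpM2l ?exprn_ge0// lerXn2r ?nnegrE ?nm_ge0//.
    by rewrite !mulr_ge0// exprn_ge0.
  rewrite exprMn mulrCA -exprM mulnC exprM -exprMn; apply: le_of_eq; congr (_ * _ ^+ n).
  by field.
apply: nm_eq0; apply/eqP; rewrite -sqrf_eq0 eq_le sqr_ge0 andbT.
have lim0 : (fun n => (3 * B) ^+ 2 * (8 / 9) ^+ n) @ \oo --> ((3 * B) ^+ 2 * 0).
  apply: cvgM; first exact: cvg_cst.
  by apply: cvg_expr; rewrite ger0_norm; lra.
rewrite mulr0 in lim0; apply: (cvgr_to_ge lim0).
exact: nearW.
Qed.

End GlidingHump.
(** * Local maps are derivations *)

Section LocalMaps.
Context {R : realType} {H : hilbertSpace R} {M : vonNeumannAlgebra H}.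
Implicit Types (a b c x q e p : M).

Lemma projB q : isproj q -> isproj (1 - q).
Proof.
move=> [sq qq]; split; first by rewrite adjB adj1 sq.
by rewrite mulrBr mulr1 mulrBl mul1r qq subrr subr0.
Qed.

Lemma projM p q : isproj p -> isproj q -> p * q = q * p -> isproj (p * q).
Proof.
move=> [sp pp] [sq qq] pq; split; first by rewrite adjM sp sq.
by rewrite mulrA -(mulrA p) -pq mulrA pp -mulrA qq.
Qed.

Lemma left_module_vanish x (psi : M -> M) : adj x = x ->
  {morph psi : a b / a + b} -> (forall r : R, {morph psi : a / r%:C *: a}) ->
  psi 1 = 0 ->
  (forall e a, isproj e -> bicomm x e -> bicomm x a -> psi (e * a) = e * psi a) ->
  psi x = 0.
Proof.
move=> sx pD pZ p1 pM; apply: opP => v; rewrite op0E.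
apply: (@projection_module_vanish _ _ _ x (fun a => psi a v)) => //.
- by move=> a b; rewrite pD.
- by move=> r a; rewrite pZ.
- by rewrite p1.
- by move=> e a pe xe xa; rewrite pM.
Qed.

(** Taking adjoints turns right multiplication by e into left multiplication;
    the conjugate-linearity of the adjoint is harmless since only real scalars
    are used. *)
Lemma right_module_vanish x (psi : M -> M) : adj x = x ->
  {morph psi : a b / a + b} -> (forall r : R, {morph psi : a / r%:C *: a}) ->
  psi 1 = 0 ->
  (forall e a, isproj e -> bicomm x e -> bicomm x a -> psi (e * a) = psi a * e) ->
  psi x = 0.
Proof.
move=> sx pD pZ p1 pM; apply: (can_inj (@adjK _ _ _)); rewrite adj0.
apply: (@left_module_vanish x (fun a => adj (psi a))) => //.
- by move=> a b; rewrite pD adjD.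
- by move=> r a; rewrite pZ adjZ.
- by rewrite p1 adj0.
- by move=> e a pe xe xa; rewrite pM// adjM pe.1.
Qed.

(** What (f) says about T once T is normalized so as to vanish at 1. *)
Definition local_map (D : M -> M) :=
  [/\ {morph D : a b / a + b}, forall r : R, {morph D : a / r%:C *: a},
      {morph D : a / 'i%C *: a}, D 1 = 0 &
      forall p b, isproj p -> p * b = 0 -> b * p = 0 -> p * D b * p = 0].

Section Derivation.
Context (D : M -> M) (DL : local_map D).

Let DD : {morph D : a b / a + b}. Proof. by case: DL. Qed.
Let DZ (r : R) : {morph D : a / r%:C *: a}. Proof. by case: DL. Qed.
Let Di : {morph D : a / 'i%C *: a}. Proof. by case: DL. Qed.
Let D1 : D 1 = 0. Proof. by case: DL. Qed.
Let D0 : D 0 = 0.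
Proof. by apply: (addrI (D 0)); rewrite -DD !addr0. Qed.
Let DN a : D (- a) = - D a.
Proof. by apply/eqP; rewrite -addr_eq0 -DD addNr D0. Qed.
Let DB a b : D (a - b) = D a - D b. Proof. by rewrite DD DN. Qed.

(** The projection 1 - s annihilates b on both sides, and it absorbs u and v. *)
Lemma local_cut s b u v : isproj s -> s * b = b -> b * s = b ->
  u * s = 0 -> s * v = 0 -> u * D b * v = 0.
Proof.
move=> ps sb bs us sv; case: DL => _ _ _ _ DP.
have uE : u * (1 - s) = u by rewrite mulrBr mulr1 us subr0.
have vE : (1 - s) * v = v by rewrite mulrBl mul1r sv subr0.
rewrite -uE -vE !mulrA -(mulrA u) -(mulrA u) DP ?mulr0 ?mul0r//.
- exact: projB.
- by rewrite mulrBl mul1r sb subrr.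
- by rewrite mulrBr mulr1 bs subrr.
Qed.

Lemma local_projl p : isproj p -> (1 - p) * D p * (1 - p) = 0.
Proof.
move=> pp; have [_ p2] := pp; apply: (@local_cut p) => //.
- by rewrite mulrBl mul1r p2 subrr.
- by rewrite mulrBr mulr1 p2 subrr.
Qed.

(** This is [local_projl] for 1 - p, since D (1 - p) = - D p. *)
Lemma local_projr p : isproj p -> p * D p * p = 0.
Proof.
move=> pp; have := local_projl (projB pp).
by rewrite subKr DB D1 sub0r mulrN mulNr => /eqP; rewrite oppr_eq0 => /eqP.
Qed.

(** The map a |-> (1 - p) (D (p a)) becomes a right module map over the
    projections e of the bicommutant of x: decompose p a along p e and p (1 - e), and
    cut with [local_cut]. Subtracting (1 - p) (D p) a makes it vanish at 1. *)
Let corner_sa p x : isproj p -> adj x = x -> p * x = x -> x * p = x ->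
  (1 - p) * D x = (1 - p) * D p * x.
Proof.
move=> pp sx px xp; have [sp p2] := pp.
have p1p : p * (1 - p) = 0 by rewrite mulrBr mulr1 p2 subrr.
have q1p : (1 - p) * p = 0 by rewrite mulrBl mul1r p2 subrr.
pose psi a := (1 - p) * D (p * a) - (1 - p) * D p * a.
suff : psi x = 0 by rewrite /psi px => /subr0_eq.
apply: right_module_vanish => //.
- by move=> a b; rewrite /psi mulrDr DD !mulrDr opprD addrACA.
- move=> r a; rewrite /psi -vN_scalerAr DZ -!vN_scalerAr -scalerBr//.
- by rewrite /psi !mulr1 subrr.
move=> e a pe xe xa; have [se e2] := pe.
have pcomm b : bicomm x b -> p * b = b * p by move=> xb; apply: xb; rewrite px.
have peC := pcomm _ xe; have paC := pcomm _ xa.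
have eaC := bicomm_comm xe xa.
have ppe : isproj (p * e) by exact: projM.
have pse : isproj (p * (1 - e)).
  by apply: projM => //; [exact: projB|rewrite mulrBr mulrBl mulr1 mul1r peC].
have h1 : (1 - p) * D (p * (1 - e) * a) * (p * e) = 0.
  have as_ : a * (p * (1 - e)) = p * (1 - e) * a.
    by apply: commrM => //; apply: commrB => //; exact: commr1.
  apply: (local_cut pse).
  - by rewrite mulrA pse.2.
  - by rewrite -mulrA as_ mulrA pse.2.
  - by rewrite mulrA q1p mul0r.
  - by rewrite [X in _ * X]peC mulrA -(mulrA p) mulrBl mul1r e2 subrr mulr0 mul0r.
have h2 : (1 - p) * D (p * e * a) * (1 - p * e) = 0.
  have as_ : a * (p * e) = p * e * a by apply: commrM.
  apply: (local_cut ppe).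
  - by rewrite mulrA ppe.2.
  - by rewrite -mulrA as_ mulrA ppe.2.
  - by rewrite mulrA q1p mul0r.
  - by rewrite mulrBr mulr1 ppe.2 subrr.
have h3 : (1 - p) * D (p * a) * (1 - p) = 0.
  apply: (local_cut pp) => //.
  - by rewrite mulrA p2.
  - by rewrite paC -mulrA p2.
have split_pa : D (p * a) = D (p * e * a) + D (p * (1 - e) * a).
  by rewrite -DD -mulrDl -mulrDr addrC subrK mulr1.
rewrite /psi [RHS]mulrBl; congr (_ - _); last by rewrite -[RHS]mulrA eaC.
rewrite (mulrA p).
have -> : (1 - p) * D (p * e * a) = (1 - p) * D (p * e * a) * (p * e).
  by apply/eqP; rewrite -subr_eq0 -{1}[_ * D _]mulr1 -mulrBr h2.
have -> : (1 - p) * D (p * a) = (1 - p) * D (p * a) * p.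
  by apply/eqP; rewrite -subr_eq0 -{1}[_ * D _]mulr1 -mulrBr h3.
by rewrite -[RHS]mulrA split_pa (mulrDr (1 - p)) [RHS]mulrDl h1 addr0.
Qed.

Lemma local_cornerl p x : isproj p -> p * x = x -> x * p = x ->
  (1 - p) * D x = (1 - p) * D p * x.
Proof.
move=> pp px xp; have [a [b [sa sb xE ab0]]] := sa_parts x.
have [|||a0 b0] := ab0 (1 - p).
- exact: (projB pp).1.
- by rewrite mulrBl mul1r px subrr.
- by rewrite mulrBr mulr1 xp subrr.
have fixl y : adj y = y -> (1 - p) * y = 0 -> p * y = y /\ y * p = y.
  move=> sy; rewrite mulrBl mul1r => /subr0_eq py; split=> //.
  by rewrite -sy -{1}pp.1 -adjM -py.
have [pa ap] := fixl _ sa a0; have [pb bp] := fixl _ sb b0.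
rewrite xE DD Di !mulrDr -!vN_scalerAr.
by rewrite (corner_sa pp sa pa ap) (corner_sa pp sb pb bp).
Qed.

End Derivation.

(** The Hochschild coboundary of D, so that defect (e a) b - e (defect a b) =
    defect e (a b) - (defect e a) b. *)
Definition defect (D : M -> M) a b := D (a * b) - D a * b - a * D b.

(** Since b = e b + (1 - e) b, with summands in the corners of e and of 1 - e,
    [local_cornerl] gives (1 - e) (D (e b)) and e (D ((1 - e) b)); no other part
    of D b contributes to the defect. *)
Lemma defect_comm D e b : local_map D -> isproj e -> e * b = b * e ->
  defect D e b = 0.
Proof.
move=> DL pe eb; have [se e2] := pe; have [DD _ _ D1 _] := DL.
have DB a c : D (a - c) = D a - D c.
  by apply: (addIr (D c)); rewrite -DD !subrK.
pose b1 := e * b; pose b2 := (1 - e) * b.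
have pf := projB pe; have [sf f2] := pf.
have h1 : (1 - e) * D b1 = (1 - e) * D e * b1.
  by apply: local_cornerl => //; rewrite /b1 ?mulrA ?e2// -mulrA -eb mulrA e2.
have fb : (1 - e) * b = b * (1 - e) by rewrite mulrBl mulrBr eb mul1r mulr1.
have h2 : (1 - (1 - e)) * D b2 = (1 - (1 - e)) * D (1 - e) * b2.
  by apply: local_cornerl => //; rewrite /b2 ?mulrA ?f2// -mulrA -fb mulrA f2.
rewrite subKr DB D1 sub0r mulrN mulNr in h2.
have bE : b = b1 + b2 by rewrite /b1 /b2 -mulrDl addrC subrK mul1r.
have e1 : e * D e * b1 = 0 by rewrite /b1 mulrA (local_projr DL pe) mul0r.
have e3 : (1 - e) * D e * b2 = 0 by rewrite /b2 mulrA (local_projl DL pe) mul0r.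
have h3 : D e * b1 = D b1 - e * D b1.
  by move: h1; rewrite !mulrBl !mul1r e1 subr0 => ->.
have h4 : D e * b2 = - (e * D b2).
  by rewrite h2 opprK; apply/subr0_eq; rewrite -e3 !mulrBl mul1r.
rewrite /defect -/b1 {1 2}bE DD !mulrDr h3 h4 -(addrA (D b1) (- (e * D b1))).
by rewrite -opprD subKr subrr.
Qed.

Lemma defect_eq0 D a b : defect D a b = 0 -> D (a * b) = D a * b + a * D b.
Proof. by move/subr0_eq/eqP; rewrite subr_eq addrC => /eqP. Qed.

Lemma defectDl D a b c : local_map D ->
  defect D (a + b) c = defect D a c + defect D b c.
Proof.
move=> [DD _ _ _ _]; rewrite /defect mulrDl !DD !mulrDl !opprD.
by rewrite [X in X + _ = _]addrACA [LHS]addrACA.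
Qed.

Lemma defectDr D a b c : local_map D ->
  defect D a (b + c) = defect D a b + defect D a c.
Proof.
move=> [DD _ _ _ _]; rewrite /defect mulrDr !DD !mulrDr !opprD.
by rewrite [X in X + _ = _]addrACA [LHS]addrACA.
Qed.

Lemma defectZl D (r : R) a b : local_map D ->
  defect D (r%:C *: a) b = r%:C *: defect D a b.
Proof.
move=> [_ DZ _ _ _]; rewrite /defect -!vN_scalerAl !DZ -!vN_scalerAl.
by rewrite -!scalerBr.
Qed.

Lemma defectil D a b : local_map D ->
  defect D ('i%C *: a) b = 'i%C *: defect D a b.
Proof.
move=> [_ _ Di _ _]; rewrite /defect -!vN_scalerAl !Di -!vN_scalerAl.
by rewrite -!scalerBr.
Qed.

Lemma defectir D a b : local_map D ->
  defect D a ('i%C *: b) = 'i%C *: defect D a b.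
Proof.
move=> [_ _ Di _ _]; rewrite /defect -!vN_scalerAr !Di -!vN_scalerAr.
by rewrite -!scalerBr.
Qed.

Lemma defect1l D b : local_map D -> defect D 1 b = 0.
Proof. by move=> [_ _ _ D1 _]; rewrite /defect D1 !mul1r mul0r subr0 subrr. Qed.

(** By the cocycle identity and [defect_comm], the hypothesis makes
    a |-> defect a b compatible with projections. *)
Lemma defect_vanish D x b : local_map D -> adj x = x ->
  (forall e a, isproj e -> bicomm x e -> bicomm x a -> defect D e (a * b) = 0) ->
  defect D x b = 0.
Proof.
move=> DL sx eab.
apply: (@left_module_vanish x (fun a => defect D a b)) => //.
- by move=> a c; exact: defectDl.
- by move=> r a; exact: defectZl.
- exact: defect1l.
move=> e a pe xe xa; rewrite {1}/defect -mulrA (defect_eq0 (eab _ _ pe xe xa)).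
have -> : D (e * a) = D e * a + e * D a.
  by apply: defect_eq0; apply: defect_comm => //; exact: bicomm_comm xe xa.
by rewrite mulrDl mulrA opprD addrACA subrr add0r /defect !mulrBr !mulrA.
Qed.

Lemma sa_vanish (Q : M -> M) : {morph Q : a b / a + b} ->
  {morph Q : a / 'i%C *: a} -> (forall a, adj a = a -> Q a = 0) ->
  forall a, Q a = 0.
Proof.
move=> QD Qi Q0 a; have [x [y [sx sy -> _]]] := sa_parts a.
by rewrite QD Qi !Q0// scaler0 addr0.
Qed.

(** Here a x still commutes with e, so that [defect_comm] applies. *)
Lemma defect_square D x : local_map D -> adj x = x -> defect D x x = 0.
Proof.
move=> DL sx; apply: defect_vanish => // e a pe xe xa.
by apply: defect_comm => //; apply: bicomm_comm xe _; exact: bicommM.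
Qed.

(** Polarization of [defect_square], then complex bilinearity: D is a Jordan
    derivation. *)
Lemma defect_antisym D a b : local_map D -> defect D a b + defect D b a = 0.
Proof.
move=> DL; pose J a b := defect D a b + defect D b a.
have JC c d : J c d = J d c by rewrite /J addrC.
have JD c d e : J (c + d) e = J c e + J d e.
  by rewrite /J defectDl// defectDr// [LHS]addrACA.
have Ji c d : J ('i%C *: c) d = 'i%C *: J c d.
  by rewrite /J defectil// defectir// -scalerDr.
rewrite -/(J a b); move: a; apply: sa_vanish => [c d|c|a sa]; rewrite ?JD ?Ji//.
rewrite JC; move: b; apply: sa_vanish => [c d|c|b sb]; rewrite ?JD ?Ji//.
have := defect_square DL (x := b + a); rewrite adjD sa sb => /(_ erefl).
rewrite defectDl// !defectDr// (defect_square DL sa) (defect_square DL sb).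
by rewrite add0r addr0.
Qed.

Lemma add_self_eq0 a : a + a = 0 -> a = 0.
Proof.
move=> /eqP; rewrite -mulr2n -scaler_nat scaler_eq0 pnatr_eq0 /=.
by move/eqP.
Qed.

Lemma jordan_product D a b : local_map D ->
  D (a * b) + D (b * a) = (D a * b + a * D b) + (D b * a + b * D a).
Proof.
move=> DL; have := defect_antisym a b DL.
have dE c d : defect D c d = D (c * d) - (D c * d + c * D d).
  by rewrite opprD addrA.
by rewrite !dE addrACA -opprD => /subr0_eq.
Qed.

(** Since b e = 0, antisymmetry gives defect e b = (D b) e + b (D e), and
    e (D e) e = 0 shows that e annihilates it from the left. *)
Lemma defect_cornerE D e b : local_map D -> isproj e -> e * b = b -> b * e = 0 ->
  defect D e b = (1 - e) * D b * e.
Proof.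
move=> DL pe eb be; have [se e2] := pe; have [DD _ _ _ _] := DL.
have D0 : D 0 = 0 by apply: (addrI (D 0)); rewrite -DD !addr0.
have w2 : defect D e b = D b * e + b * D e.
  apply/eqP; rewrite -(subr0 (defect D e b)) -[X in _ - X](defect_antisym e b DL).
  by rewrite opprD addNKr /defect be D0 sub0r -opprD opprK.
have ew : e * defect D e b = 0.
  rewrite /defect eb !mulrBr !mulrA e2 -eb !mulrA -(mulrA _ e b) eb.
  by rewrite -{2}eb !mulrA (local_projr DL pe) mul0r subr0 subrr.
have fb : (1 - e) * b = 0 by rewrite mulrBl mul1r eb subrr.
have -> : defect D e b = (1 - e) * defect D e b.
  by rewrite mulrBl mul1r ew subr0.
by rewrite w2 mulrDr !mulrA fb mul0r addr0.
Qed.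

(** Write W c for the defect of e at c in e M (1 - e), an element of
    (1 - e) M e. Products of elements of e M (1 - e) vanish, so the Jordan identity
    for b and c yields (W b) c = - (W c) b, and for b alone b (W b) = 0. With
    w = W b and c = w^*, it follows that (w w^* )^2 = - (W c) b w w^* = 0, whence
    w = 0. *)
Lemma defect_corner D e b : local_map D -> isproj e -> e * b = b -> b * e = 0 ->
  defect D e b = 0.
Proof.
move=> DL pe eb be; have [se e2] := pe; have [DD _ _ _ _] := DL.
have D0 : D 0 = 0 by apply: (addrI (D 0)); rewrite -DD !addr0.
have ef : e * (1 - e) = 0 by rewrite mulrBr mulr1 e2 subrr.
rewrite defect_cornerE//; pose W c := (1 - e) * D c * e; rewrite -/(W b).
have fl c : e * c = c -> (1 - e) * c = 0.
  by move=> ec; rewrite mulrBl mul1r ec subrr.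
have corner0 c d : c * e = 0 -> e * d = d -> c * d = 0.
  by move=> ce <-; rewrite mulrA ce mul0r.
have W1 c : e * c = c -> c * e = 0 -> W b * c = - (W c * b).
  move=> ec ce; have := jordan_product b c DL.
  rewrite (corner0 _ _ be ec) (corner0 _ _ ce eb) D0 addr0 => h.
  have {h} := congr1 (fun z => (1 - e) * z) h.
  rewrite mulr0 !mulrDr !mulrA (fl _ eb) (fl _ ec) !mul0r !addr0 => h.
  apply/eqP; rewrite -addr_eq0 /W -mulrA ec -(mulrA _ e b) eb.
  by rewrite -h.
have W2 : b * W b = 0.
  rewrite /W !mulrA mulrBr mulr1 be subr0; apply: add_self_eq0.
  have := jordan_product b b DL.
  rewrite (corner0 _ _ be eb) D0 addr0 => h.
  have {h} := congr1 (fun z => z * e) h.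
  rewrite mul0r !mulrDl -!(mulrA _ b e) be !mulr0 !add0r => h.
  by rewrite -h.
have We : W b * e = W b by rewrite /W -mulrA e2.
have eW : e * W b = 0 by rewrite /W !mulrA ef !mul0r.
set w := W b in W2 We eW *.
have ec : e * adj w = adj w by rewrite -{1}se -adjM We.
have ce : adj w * e = 0 by rewrite -{1}se -adjM eW adj0.
have sww : adj (w * adj w) = w * adj w by rewrite adjM adjK.
have ww : w * adj w = 0.
  apply: adj_mul_eq0; rewrite sww {1}(W1 _ ec ce) mulrA mulNr -(mulrA _ b) W2.
  by rewrite mulr0 oppr0 mul0r.
apply: (can_inj (@adjK _ _ _)); rewrite adj0; apply: adj_mul_eq0.
by rewrite adjK.
Qed.

(** Peirce decomposition of b with respect to e. The component in (1 - e) M e is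
    handled by 1 - e, as the defects of e and 1 - e add up to that of 1. *)
Lemma defect_proj D e b : local_map D -> isproj e -> defect D e b = 0.
Proof.
move=> DL pe; have [se e2] := pe.
have ebee : e * b * e * e = e * b * e by rewrite -mulrA e2.
pose b1 := e * b * e + (b - e * b - (b * e - e * b * e)).
pose b2 := e * b - e * b * e.
pose b3 := b * e - e * b * e.
have bE : b = b1 + b2 + b3.
  by rewrite /b1 /b2 (addrC (e * b)) [X in _ = X + _]addrACA subrr add0r addrAC
    subrK subrK.
have h1 : defect D e b1 = 0.
  apply: defect_comm => //; apply: (@etrans _ _ (e * b * e)).
    by rewrite /b1 mulrDr !mulrBr !mulrA e2 !subrr ?subr0 addr0.
  by rewrite /b1 mulrDl !mulrBl ebee -(mulrA b) e2 subrr addr0.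
have h2 : defect D e b2 = 0.
  apply: defect_corner => //.
    by rewrite mulrBr !mulrA e2.
  by rewrite /b2 mulrBl ebee subrr.
have h3 : defect D e b3 = 0.
  have h : defect D (1 - e) b3 = 0.
    apply: defect_corner => //; first exact: projB.
      by rewrite mulrBl mul1r mulrBr !mulrA e2 subrr subr0.
    by rewrite mulrBr mulr1 mulrBl ebee -(mulrA b) e2 subrr.
  have := defectDl (1 - e) e b3 DL.
  by rewrite subrK defect1l// h add0r => <-.
by clearbody b1 b2 b3; rewrite bE !defectDr// h1 h2 h3 !addr0.
Qed.

Lemma local_map_derivation D a b : local_map D ->
  D (a * b) = D a * b + a * D b.
Proof.
move=> DL; apply: defect_eq0; move: a; apply: sa_vanish => [a c|a|a sa].
- exact: defectDl.
- exact: defectil.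
- by apply: defect_vanish => // e c pe _ _; exact: defect_proj.
Qed.

End LocalMaps.
(** * Range projections *)

Section RangeProjections.
Context {R : realType} {H : hilbertSpace R} {M : vonNeumannAlgebra H}.
Implicit Types (a b c x q e p : M).

Lemma projectionP q : projection q <-> isproj q.
Proof. by split=> -[/selfadjointP sq qq]; split=> //; apply/selfadjointP. Qed.

(** The complement of the kernel projection of b is the least projection fixing b
    from the left. *)
Lemma range_projectionP b : selfadjoint b -> is_range_projection b (range_projection b).
Proof.
move=> /selfadjointP sb; apply: (@xgetPex _ 0 [set p | is_range_projection b p]).
have [q [sq qq bq _ qker]] := kernel_projection sb.
have qb : q * b = 0 by rewrite -sq -sb -adjM bq adj0.
exists (1 - q); split.
- by apply/projectionP; exact: projB.
- by rewrite mulrBl mul1r qb subr0.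
- move=> p /projectionP[sp pp] pb; rewrite /proj_le.
  have b1p : b * (1 - p) = 0.
    by rewrite mulrBr mulr1 -{2}sb -{1}sp -adjM pb sb subrr.
  have q1p : q * (1 - p) = 1 - p.
    by apply: opP => v; rewrite opME qker// -opME b1p.
  apply/esym/subr0_eq; rewrite -{1}[1 - q]mulr1 -mulrBr mulrBl mul1r q1p.
  exact: subrr.
Qed.

Lemma range_projection_orth b p : selfadjoint b -> isproj p -> p * b = 0 ->
  p * (1 - range_projection b) = p /\ (1 - range_projection b) * p = p.
Proof.
move=> sb pp pb; have [sp _] := pp.
have [/projectionP[sr _] _ rmin] := range_projectionP sb.
have := rmin (1 - p); rewrite mulrBl mul1r pb subr0.
move=> /(_ ((projectionP _).2 (projB pp)) erefl).
rewrite /proj_le mulrBr mulr1; set r := range_projection b => h.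
have rp : r * p = 0 by rewrite -(subKr r (r * p)) h subrr.
have pr : p * r = 0.
  by have := congr1 (@adj _ _ _) rp; rewrite adjM sp sr adj0.
by rewrite mulrBr mulrBl mul1r mulr1 rp pr subr0.
Qed.

End RangeProjections.

(** * Generalized derivations *)

Section Functionals.
Context {R : realType} {H : hilbertSpace R} {M : vonNeumannAlgebra H}.
Implicit Types (a b c : M) (v w : H).

Lemma dot_le v w : `|hs_dot H v w| <= (2 * nm v * nm w)%:C.
Proof.
have nmi : nm ('i%C *: w) = nm w.
  by rewrite nmZc normc_def /= expr0n expr1n add0r sqrtr1 mul1r.
have sq_le t : ip v t ^+ 2 <= (nm v * nm t) ^+ 2.
  have := ip_CS v t; have := ip_CS v (- t); rewrite ipNr nmN; nra.
have hre : complex.Re (hs_dot H v w) ^+ 2 <= (nm v * nm w) ^+ 2 by exact: sq_le.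
have him : complex.Im (hs_dot H v w) ^+ 2 <= (nm v * nm w) ^+ 2.
  by rewrite ip_iIm -nmi; exact: sq_le.
rewrite normc_def lecR -(ler_pXn2r (_ : (0 < 2)%N)) ?nnegrE ?sqrtr_ge0//; last first.
  by rewrite !mulr_ge0// nm_ge0.
rewrite sqr_sqrtr ?addr_ge0 ?sqr_ge0//; nra.
Qed.

Lemma vector_functional_subproof c v w :
  (fun y : M => hs_dot H ((y * c) v) w) \in bounded_operator M R[i]^o.
Proof.
apply: (@bounded_operatorP _ _ _ _ (2 * nm (c v) * nm w)%:C) => [k y z||y].
- by rewrite mulrDl -vN_scalerAl !opE linearDl linearZl_LR.
- by rewrite lecR !mulr_ge0// nm_ge0.
- apply: le_trans (dot_le _ _) _; rewrite opME.
  have h := bop_norm_ge (vN_val y) (c v).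
  have -> : (2 * nm (y (c v)) * nm w)%:C = `|y (c v)| * (2 * nm w)%:C.
    by rewrite normcE -rmorphM; congr _%:C; ring.
  have -> : (2 * nm (c v) * nm w)%:C * `|y| = `|vN_val y| * `|c v| * (2 * nm w)%:C.
    rewrite [`|c v|]normcE -!rmorphM; congr _%:C; ring.
  by rewrite ler_wpM2r// lecR mulr_ge0// nm_ge0.
Qed.

Definition vector_functional c v w : dual M := Bop (vector_functional_subproof c v w).

(** The functional F below satisfies F (y b) = 0 for all y. In the Arens product
    this reads b.F = 0, so the term with xi vanishes on F whatever xi is. *)
Lemma generalized_derivation_zero (T : M -> M) a b c : generalized_derivation T ->
  a * b = 0 -> b * c = 0 -> a * T b * c = 0.
Proof.
move=> [TL [xi Txi]] ab bc.
have T0 : T 0 = 0 by have := TL (-1) 0 0; rewrite scaler0 add0r scaleN1r addNr.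
apply: opP => v; apply: ip_eq0 => w.
pose F := vector_functional c v w.
have FE y : F y = hs_dot H ((y * c) v) w by [].
have F0 : bidual_act (bidual_in b) F = 0.
  apply: bopP => y; change (F (y * b) = 0).
  by rewrite FE -mulrA bc mulr0 op0E linear0l.
have /(congr1 (fun m : bidual M => m F)) := Txi a b.
rewrite ab T0.
change (F 0 = F (T a * b) + F (a * T b) -
  arens (bidual_in a) xi (bidual_act (bidual_in b) F) -> ip ((a * T b * c) v) w = 0).
have Z (m : bidual M) : m 0 = 0 by exact: linear0.
rewrite F0 Z linear0 subr0 !FE -mulrA bc mulr0 !op0E linear0l add0r => h.
by rewrite /ip -h.
Qed.

End Functionals.

(** T x - (g x + x g) with g = T(1)/2 is a local map, hence a derivation; the
    identity for T follows with xi = T 1 = 2 g. *)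
Lemma orthogonal_generalized_derivation (R : realType) (H : hilbertSpace R)
    (M : vonNeumannAlgebra H) (T : {linear M -> M}) :
  (forall p b : M, isproj p -> selfadjoint b -> p * b = 0 -> p * T b * p = 0) ->
  generalized_derivation T.
Proof.
move=> TP; split; first exact: linearP.
pose h := T 1; pose g := (2^-1)%:C *: h.
have gg : g + g = h.
  rewrite /g -scalerDl -rmorphD (_ : 2^-1 + 2^-1 = 1 :> R) ?scale1r//; lra.
clearbody g; pose D x := T x - (g * x + x * g).
have DL : local_map D.
  split.
  - by move=> a b; rewrite /D linearD mulrDl mulrDr [X in _ - X]addrACA opprD addrACA.
  - by move=> r a; rewrite /D linearZ -vN_scalerAr -vN_scalerAl -scalerDr -scalerBr.
  - by move=> a; rewrite /D linearZ -vN_scalerAr -vN_scalerAl -scalerDr -scalerBr.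
  - by rewrite /D mulr1 mul1r gg subrr.
  - move=> p b pp pb bp; have [sp _] := pp.
    have pTp : p * T b * p = 0.
      have [x [y [sx sy bE xy0]]] := sa_parts b.
      have [px py] := xy0 _ sp pb bp.
      rewrite bE linearD linearZ mulrDr mulrDl -vN_scalerAr -vN_scalerAl.
      by rewrite !TP ?scaler0 ?addr0//; apply/selfadjointP.
    rewrite /D mulrBr mulrBl pTp mulrDr mulrDl !mulrA pb mul0r mul0r addr0.
    by rewrite -(mulrA (p * g)) bp mulr0 subr0.
exists (bidual_in h) => a b; rewrite !arens_bidual_in.
have TE x : T x = D x + (g * x + x * g) by rewrite /D subrK.
clearbody D.
have -> : T (a * b) = T a * b + a * T b - a * h * b.
  rewrite !TE (local_map_derivation _ _ DL) -gg !mulrDl !mulrDr !mulrDl !mulrA.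
  set A := D a * b; set B := a * D b; set X := g * a * b; set Y := a * g * b.
  set Z := a * b * g.
  have -> : A + (X + Y) + (B + (Y + Z)) = A + B + (X + Z) + (Y + Y).
    by rewrite addrACA (addrC Y Z) (addrACA X) addrA.
  by rewrite addrK.
by apply: bopP => F; change (F (T a * b + a * T b - a * h * b) = F (T a * b) + F (a * T b) - F (a * h * b)); rewrite linearB linearD.
Qed.

Unset Implicit Arguments.
Set Strict Implicit.

Theorem corollary2p15 (R : realType) (H : hilbertSpace R)
    (M : vonNeumannAlgebra H) (T : {linear M -> M}) :
  [<->
    (* (a) *) generalized_derivation T;
    (* (b) *) forall a b c : M, a * b = 0 -> b * c = 0 -> a * T b * c = 0;
    (* (c) *) forall a b c : M,
      selfadjoint a -> selfadjoint b -> selfadjoint c ->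
      a * b = 0 -> b * c = 0 -> a * T b * c = 0;
    (* (d) *) forall a b c : M,
      selfadjoint a -> selfadjoint b -> selfadjoint c ->
      a * b = 0 -> b * c = 0 -> a * T b * c + c * T b * a = 0;
    (* (e) *) forall a b : M, selfadjoint a -> selfadjoint b ->
      a * b = 0 -> a * T b * a = 0;
    (* (f) *) forall b : M, selfadjoint b ->
      (1 - range_projection b) * T b * (1 - range_projection b) = 0].
Proof.
have adj_eq0 (a b : M) : adj a = a -> adj b = b -> a * b = 0 -> b * a = 0.
  by move=> sa sb ab; rewrite -sa -sb -adjM ab adj0.
tfae.
- by move=> GT a b c; exact: generalized_derivation_zero.
- by move=> Tb a b c _ _ _; exact: Tb.
- move=> Tc a b c sa sb sc ab bc; rewrite Tc// add0r Tc//.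
    by apply: adj_eq0 => //; exact/selfadjointP.
  by apply: adj_eq0 => //; exact/selfadjointP.
- move=> Td a b sa sb ab; apply: add_self_eq0; apply: Td => //.
  by apply: adj_eq0 => //; exact/selfadjointP.
- move=> Te b sb; have [[sr rr] rb _] := range_projectionP sb.
  apply: Te => //; last by rewrite mulrBl mul1r rb subrr.
  by apply/selfadjointP; rewrite adjB adj1; congr (_ - _); exact/selfadjointP.
- move=> Tf; apply: orthogonal_generalized_derivation => p b pp sb pb.
  have [h1 h2] := range_projection_orth sb pp pb.
  by rewrite -{2}h2 -{1}h1 mulrA -(mulrA p) -(mulrA p) Tf// mulr0 mul0r.
Qed.
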